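(* The free group $\mathbb F_{\aleph_c}$ on a set of generators of cardinality continuum is hyperlinear. In particular, for $\omega$ a free ultrafilter on $\mathbb N$, $R^\omega$ is not separable.
   Context: $R$ is the hyperfinite type $II_1$ factor; for a free ultrafilter $\rho$ on $\mathbb N$, $R^\rho$ is the tracial ultrapower of $R$, $\tau$ its trace, $U(R^\rho)$ its unitary group. A group $H$ (not necessarily countable) is hyperlinear if for some free ultrafilter $\rho$ on $\mathbb N$ there is a homomorphism $\theta:H\to U(R^\rho)$ with $\tau(\theta(h))=0$ for all $h\neq e$. Separability of $R^\omega$ refers to the weak (equivalently, strong) operator topology, in the standard representation on $L^2(R^\omega,\tau)$. *)

(* Defs.v *)
From HB Require Import structures.
From mathcomp Require Import all_boot all_order all_algebra.
From mathcomp Require Import sesquilinear generic_quotient complex.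
From mathcomp Require Import all_classical all_reals.
From mathcomp Require Import topology normedtype.
Import Order.TTheory GRing.Theory Num.Theory Num.Def numFieldNormedType.Exports.

Set Implicit Arguments.
Unset Strict Implicit.
Unset Printing Implicit Defensive.

Local Open Scope classical_set_scope.
Local Open Scope ring_scope.
Local Open Scope quotient_scope.

Reserved Notation "''<' x , y >"
  (at level 2, x at level 60, y at level 60, format "''<' x ,  y >").

(* The inner product is linear in its first argument. *)
Record hilbert (K : realType) := Hilbert {
  hspace :> completeNormedModType K[i];
  dotp : {dot hspace for (@conjC K[i])};
  dotpE : forall x, `|x| ^+ 2 = dotp x x }.

Section Operators.
Variables (K : realType) (H : hilbert K).
Local Notation "''<' x , y >" := (dotp H x y).
Implicit Types (S T : H -> H) (A : set (H -> H)).

(* B(H) *)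
Definition bounded_op : set (H -> H) := [set T | linear T /\ continuous T].

Definition is_adjoint T S := forall x y, '<T x, y> = '<x, S y>.

(* The default value is irrelevant: adj is only applied to elements of
   *-closed sets of bounded operators. *)
Definition adj T : H -> H := xget 0 [set S | is_adjoint T S].

(* The strong operator topology is the topology of pointwise convergence;
   the weak operator topology is the coarsest one making all matrix
   coefficients T |-> <T x, y> continuous. *)
Definition sot_closure A : set (H -> H) := closure (A : set {ptws H -> H}).

Definition mcoef T : {ptws (H * H) -> K[i]^o} := fun p => '<T p.1, p.2>.

Definition wot_closure A : set (H -> H) :=
  [set T | closure (mcoef @` A) (mcoef T)].

Definition sot_separable A :=
  exists D, [/\ countable D, D `<=` A & A `<=` sot_closure D].

Definition wot_separable A :=
  exists D, [/\ countable D, D `<=` A & A `<=` wot_closure D].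

Definition finite_dim A := exists n (e : 'I_n -> H -> H),
  forall T, A T -> exists c : 'I_n -> K[i], T = \sum_i c i *: e i.

(* Not necessarily unital *)
Record star_algebra A : Prop := StarAlgebra {
  star_bounded : A `<=` bounded_op;
  star_zero : A 0;
  star_linear : forall c S T, A S -> A T -> A (c *: S + T);
  star_mul : forall S T, A S -> A T -> A (S \o T);
  star_adj : forall T, A T -> exists2 S, A S & is_adjoint T S }.

Record von_neumann_algebra A : Prop := VonNeumannAlgebra {
  vn_star :> star_algebra A;
  vn_one : A id;
  vn_closed : wot_closure A `&` bounded_op `<=` A }.

Definition is_factor A := forall Z, A Z ->
  (forall T, A T -> Z \o T = T \o Z) -> exists c : K[i], Z = c *: id.

Record tracial_state A (tau : (H -> H) -> K[i]) : Prop := TracialState {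
  tr_linear : forall c S T, A S -> A T ->
    tau (c *: S + T) = c * tau S + tau T;
  tr_one : tau id = 1;
  tr_ge0 : forall T, A T -> 0 <= tau (adj T \o T);
  tr_comm : forall S T, A S -> A T -> tau (S \o T) = tau (T \o S) }.

Definition faithful A (tau : (H -> H) -> K[i]) :=
  forall T, A T -> tau (adj T \o T) = 0 -> T = 0.

(* Normality (ultraweak continuity): the restriction of tau to the unit ball
   of A is continuous for the weak operator topology. *)
Definition normal_functional A (tau : (H -> H) -> K[i]) :=
  forall B, B `<=` A `&` [set T | forall x, `|T x| <= `|x|] ->
  forall T, A T -> wot_closure B T ->
  closure (tau @` B : set K[i]^o) (tau T).

(* The faithful normal tracial state of a II_1 factor is unique, so bundling
   it with the factor adds no choice. *)
Record II1_factor := II1Factor {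
  carrier : set (H -> H);
  trace : (H -> H) -> K[i];
  II1_vn : von_neumann_algebra carrier;
  II1_factorial : is_factor carrier;
  II1_infinite : ~ finite_dim carrier;
  II1_tracial : tracial_state carrier trace;
  II1_faithful : faithful carrier trace;
  II1_normal : normal_functional carrier trace }.

Definition hyperfinite A := exists F : nat -> set (H -> H),
  [/\ forall n, star_algebra (F n) /\ finite_dim (F n),
      forall n, F n `<=` F n.+1,
      forall n, F n `<=` A
    & A `<=` wot_closure (\bigcup_n F n)].

End Operators.

Section HilbertTheory.
Variables (K : realType) (H : hilbert K).
Local Notation "''<' x , y >" := (dotp H x y).
Implicit Types (x y : H) (S T : H -> H).

Lemma dotpC x y : '<x, y> = conjC '<y, x>.
Proof. by rewrite (@hermitian_subproof _ _ _ _ (dotp H)) expr0 mul1r. Qed.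

Lemma dotpDl x y z : '<x + y, z> = '<x, z> + '<y, z>.
Proof. exact: linearDl. Qed.

Lemma dotpZl a x z : '<a *: x, z> = a * '<x, z>.
Proof. exact: linearZl_LR. Qed.

Lemma dotpDr x y z : '<z, x + y> = '<z, x> + '<z, y>.
Proof. by rewrite dotpC dotpDl rmorphD /= -!dotpC. Qed.

Lemma dotpZr a x z : '<z, a *: x> = conjC a * '<z, x>.
Proof. by rewrite dotpC dotpZl rmorphM /= -!dotpC. Qed.

Lemma dotpNl x z : '<- x, z> = - '<x, z>.
Proof. by rewrite -scaleN1r dotpZl mulN1r. Qed.

Lemma dotpNr x z : '<z, - x> = - '<z, x>.
Proof. by rewrite dotpC dotpNl rmorphN /= -dotpC. Qed.

Lemma dotp_injr x y : (forall z, '<z, x> = '<z, y>) -> x = y.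
Proof.
move=> xy; apply/eqP; rewrite -subr_eq0 -normr_eq0 -sqrf_eq0 dotpE.
by rewrite dotpDr dotpNr xy subrr.
Qed.

Lemma dotp_cauchy_schwarz x y : `|'<x, y>| <= `|x| * `|y|.
Proof.
have [->|y0] := eqVneq y 0.
  by rewrite -(scale0r (0 : H)) dotpZr conjC0 mul0r !normrZ !normr0 !mul0r mulr0.
have yy0 : 0 < `|y| ^+ 2 by rewrite exprn_gt0 // normr_gt0.
have yyr : conjC (`|y| ^+ 2) = `|y| ^+ 2.
  by apply/CrealP; rewrite realE (ltW yy0).
pose a := '<x, y> / `|y| ^+ 2.
have := exprn_ge0 2 (normr_ge0 (x - a *: y)).
rewrite dotpE dotpDl !dotpDr dotpNl !dotpNr dotpNl !dotpZl !dotpZr -!dotpE.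
rewrite (dotpC y x) opprK.
have ay : conjC a * `|y| ^+ 2 = conjC '<x, y>.
  by rewrite -[in X in _ * X]yyr -rmorphM /a divfK // gt_eqF.
rewrite ay addNr addr0 subr_ge0 => h.
have {h} : '<x, y> * conjC '<x, y> <= `|x| ^+ 2 * `|y| ^+ 2.
  by have := ler_wpM2r (ltW yy0) h; rewrite mulrAC ay mulrC.
by rewrite -normCK -exprMn ler_pXn2r // ?nnegrE ?mulr_ge0.
Qed.

Lemma adj_unique S T : is_adjoint T S -> adj T = S.
Proof.
move=> TS; apply/funext => y; apply: dotp_injr => x.
rewrite -TS; have := @xgetPex _ 0 [set S | is_adjoint T S] (ex_intro _ S TS).
by rewrite -/(adj T) /= => <-.
Qed.

Lemma is_adjoint_bound (c : K[i]) S T : is_adjoint T S ->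
  (forall x, `|T x| <= c * `|x|) -> forall x, `|S x| <= c * `|x|.
Proof.
move=> TS Tc x; have [->|Sx0] := eqVneq (S x) 0.
  by rewrite normr0 (le_trans _ (Tc x)).
have n0 : 0 < `|S x| by rewrite normr_gt0.
rewrite -(ler_pM2l n0) -expr2 dotpE -TS mulrA [_ * c]mulrC.
apply: (@le_trans _ _ `|'<T (S x), x>|).
  by rewrite TS -dotpE normrX normr_id.
by rewrite (le_trans (dotp_cauchy_schwarz _ _)) // ler_wpM2r.
Qed.

Section StarAlgebraTheory.
Variables (A : set (H -> H)) (As : star_algebra A).

Lemma adjP T : A T -> is_adjoint T (adj T).
Proof. by case/(star_adj As) => S _ TS; rewrite (adj_unique TS). Qed.

Lemma adj_mem T : A T -> A (adj T).
Proof. by case/(star_adj As) => S AS TS; rewrite (adj_unique TS). Qed.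

Lemma star_add S T : A S -> A T -> A (S + T).
Proof. by move=> AS AT; rewrite -[S]scale1r; apply: star_linear. Qed.

Lemma star_opp T : A T -> A (- T).
Proof.
by move=> AT; rewrite -[- T]addr0 -scaleN1r; apply: star_linear (star_zero As).
Qed.

Lemma star_sub S T : A S -> A T -> A (S - T).
Proof. by move=> AS AT; apply: star_add => //; apply: star_opp. Qed.

Lemma adjD S T : A S -> A T -> adj (S + T) = adj S + adj T.
Proof.
move=> AS AT; apply: adj_unique => x y.
by rewrite dotpDl dotpDr (adjP AS) (adjP AT).
Qed.

Lemma adjN T : A T -> adj (- T) = - adj T.
Proof.
by move=> AT; apply: adj_unique => x y; rewrite dotpNl dotpNr (adjP AT).
Qed.

Lemma star_additive T x y : A T -> T (x + y) = T x + T y.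
Proof.
by case/(star_bounded As) => Tl _; have := Tl 1 x y; rewrite !scale1r.
Qed.

Lemma star_at0 T : A T -> T 0 = 0.
Proof.
move=> AT; have := star_additive 0 0 AT; rewrite addr0.
by move/(congr1 (fun y => y - T 0)); rewrite addrK subrr.
Qed.

Lemma star_atN T x : A T -> T (- x) = - T x.
Proof.
move=> AT; apply/eqP; rewrite -addr_eq0 -(star_additive _ _ AT) addNr.
by rewrite (star_at0 AT).
Qed.

End StarAlgebraTheory.

End HilbertTheory.

Record free_ultrafilter := FreeUltrafilter {
  ufilter :> set_system nat;
  ufilter_ultra : UltraFilter ufilter;
  ufilter_free : forall n, ~ ufilter [set n] }.

#[global] Existing Instance ufilter_ultra.

Section Ultrapower.
Variables (K : realType) (H : hilbert K) (R : II1_factor H).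

Let Rs : star_algebra (carrier R) := vn_star (II1_vn R).

Definition bounded_seq (x : nat -> H -> H) :=
  exists c : K[i], forall n v, `|x n v| <= c * `|v|.

(* l^oo(N, R) *)
Record linfty := LInfty {
  lseq :> nat -> H -> H;
  lseq_mem : forall n, carrier R (lseq n);
  lseq_bounded : bounded_seq lseq }.

HB.instance Definition _ := gen_eqMixin linfty.
HB.instance Definition _ := gen_choiceMixin linfty.

Fact lone_bounded : bounded_seq (fun=> id).
Proof. by exists 1 => n v; rewrite mul1r. Qed.

Definition lone : linfty :=
  LInfty (fun=> vn_one (II1_vn R)) lone_bounded.

Fact lmul_bounded (x y : linfty) : bounded_seq (fun n => x n \o y n).
Proof.
case: (lseq_bounded x) (lseq_bounded y) => c xc [d yd].
exists (`|c| * d) => n v /=; rewrite (le_trans (xc _ _)) //.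
apply: (@le_trans _ _ (`|c| * `|y n v|)); last first.
  by rewrite -mulrA ler_wpM2l.
have := xc n (y n v); have [->|y0 h] := eqVneq (y n v) 0.
  by rewrite normr0 !mulr0.
have n0 : 0 < `|y n v| by rewrite normr_gt0.
by rewrite ler_pM2r // ger0_norm // -(pmulr_lge0 _ n0) (le_trans _ h).
Qed.

Definition lmul (x y : linfty) : linfty :=
  LInfty (fun n => star_mul Rs (lseq_mem x n) (lseq_mem y n))
         (lmul_bounded x y).

Fact lstar_bounded (x : linfty) : bounded_seq (fun n => adj (x n)).
Proof.
case: (lseq_bounded x) => c xc; exists c => n.
exact: is_adjoint_bound (adjP Rs (lseq_mem x n)) (xc n).
Qed.

Definition lstar (x : linfty) : linfty :=
  LInfty (fun n => adj_mem Rs (lseq_mem x n)) (lstar_bounded x).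

(* The square of the 2-norm ||T||_2 = trace (T^* T)^(1/2) *)
Definition sqnorm2 (T : H -> H) : K[i] := trace R (adj T \o T).

Let traceD S T : carrier R S -> carrier R T ->
  trace R (S + T) = trace R S + trace R T.
Proof.
move=> RS RT.
by have := tr_linear (II1_tracial R) 1 RS RT; rewrite scale1r mul1r.
Qed.

Let trace0 : trace R 0 = 0.
Proof.
apply: (addrI (trace R 0)).
by rewrite -traceD ?addr0 //; exact: star_zero Rs.
Qed.

Let traceN T : carrier R T -> trace R (- T) = - trace R T.
Proof.
move=> RT; apply/eqP; rewrite -addr_eq0 -traceD //; last exact: star_opp.
by rewrite addNr trace0.
Qed.

Lemma sqnorm2_ge0 T : carrier R T -> 0 <= sqnorm2 T.
Proof. exact: tr_ge0 (II1_tracial R) _. Qed.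

Lemma sqnorm2_0 : sqnorm2 0 = 0.
Proof.
rewrite /sqnorm2 (_ : adj 0 \o 0 = 0) ?trace0 //.
by apply/funext => x /=; exact: star_at0 (adj_mem Rs (star_zero Rs)).
Qed.

Lemma sqnorm2N T : carrier R T -> sqnorm2 (- T) = sqnorm2 T.
Proof.
move=> RT; rewrite /sqnorm2 (adjN Rs RT); congr (trace R _).
apply/funext => x; apply: etrans (opprK (adj T (T x))).
have h := star_atN Rs (T x) (adj_mem Rs RT).
exact: (congr1 (fun y : H => - y) h).
Qed.

Let sqnorm2D_exp S T : carrier R S -> carrier R T -> sqnorm2 (S + T) =
  sqnorm2 S + sqnorm2 T + (trace R (adj S \o T) + trace R (adj T \o S)).
Proof.
move=> RS RT; have RS' := adj_mem Rs RS; have RT' := adj_mem Rs RT.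
rewrite /sqnorm2 (adjD Rs RS RT).
have -> : (adj S + adj T) \o (S + T) =
    ((adj S \o S) + (adj T \o T)) + ((adj S \o T) + (adj T \o S)).
  apply/funext => x /=.
  rewrite [LHS]/(adj S (S x + T x) + adj T (S x + T x)).
  rewrite (star_additive Rs _ _ RS') (star_additive Rs _ _ RT').
  rewrite (addrC (adj T (S x)) (adj T (T x))).
  exact: addrACA.
have m1 := star_mul Rs RS' RS; have m2 := star_mul Rs RT' RT.
have m3 := star_mul Rs RS' RT; have m4 := star_mul Rs RT' RS.
have a1 := star_add Rs m1 m2; have a2 := star_add Rs m3 m4.
by rewrite (traceD a1 a2) (traceD m1 m2) (traceD m3 m4).
Qed.

Lemma sqnorm2_parallelogram S T : carrier R S -> carrier R T ->
  sqnorm2 (S + T) + sqnorm2 (S - T) = (sqnorm2 S + sqnorm2 T) *+ 2.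
Proof.
move=> RS RT; have RT' := star_opp Rs RT.
rewrite !sqnorm2D_exp // (sqnorm2N RT).
have -> : adj S \o - T = - (adj S \o T).
  by apply/funext => x; have h := star_atN Rs (T x) (adj_mem Rs RS); exact: h.
have -> : adj (- T) \o S = - (adj T \o S).
  by rewrite (adjN Rs RT).
rewrite (traceN (star_mul Rs (adj_mem Rs RS) RT)).
rewrite (traceN (star_mul Rs (adj_mem Rs RT) RS)).
by rewrite -opprD addrACA subrr addr0 mulr2n.
Qed.

Variable omega : free_ultrafilter.

Definition leqv (x y : linfty) : Prop :=
  (fun n => sqnorm2 (x n - y n)) @ ufilter omega --> (0 : K[i]^o).

Lemma leqv_refl x : leqv x x.
Proof.
rewrite /leqv (_ : (fun n => _) = (fun=> 0)); first exact: (@cvg_cst K[i]^o).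
by apply/funext => n; rewrite subrr sqnorm2_0.
Qed.

Lemma leqv_sym x y : leqv x y -> leqv y x.
Proof.
rewrite /leqv (_ : (fun n => sqnorm2 (x n - y n)) = 
  (fun n => sqnorm2 (y n - x n))) //.
apply/funext => n; rewrite -opprB sqnorm2N //.
by apply: (star_sub Rs); apply: lseq_mem.
Qed.

Lemma leqv_trans x y z : leqv x y -> leqv y z -> leqv x z.
Proof.
move=> xy yz; have ff : Filter (ufilter omega) by exact: _.
have xyz := cvgMn (FF := ff) (V := K[i]^o) (n := 2) (cvgD (FF := ff) (V := K[i]^o) xy yz).
move: xyz; rewrite /leqv addr0 mul0rn => xyz.
apply/(cvgr0Pnorm_lt (V := K[i]^o)) => e e0.
have {xyz} := (cvgr0Pnorm_lt (FF := ff) (V := K[i]^o) _).1 xyz e e0.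
apply: filterS => n /=; apply: le_lt_trans.
have Rxy : carrier R (x n - y n).
  by apply: (star_sub Rs); apply: lseq_mem.
have Ryz : carrier R (y n - z n).
  by apply: (star_sub Rs); apply: lseq_mem.
have -> : x n - z n = (x n - y n) + (y n - z n) by rewrite addrA subrK.
rewrite ger0_norm; last by apply: sqnorm2_ge0; apply: (star_add Rs).
rewrite ger0_norm; last by rewrite mulrn_wge0 // addr_ge0 // sqnorm2_ge0.
rewrite -sqnorm2_parallelogram // lerDl sqnorm2_ge0 //.
exact: (star_sub Rs).
Qed.

Let leqvb (x y : linfty) := `[< leqv x y >].

Fact leqvb_equiv : equiv_class_of leqvb.
Proof.
split=> [x | x y | y x z]; first exact/asboolP/leqv_refl.
  by apply/asboolP/asboolP; apply: leqv_sym.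
by move=> /asboolP xy /asboolP yz; apply/asboolP; apply: leqv_trans xy yz.
Qed.

Canonical leqv_equiv : equiv_rel linfty := EquivRelPack leqvb_equiv.

(* R^omega = l^oo(N, R) / {x | lim_omega ||x_n||_2 = 0} *)
Definition ultrapower : Type := {eq_quot leqv_equiv}.

Definition up_class (x : linfty) : ultrapower := \pi_{eq_quot leqv_equiv} x.

Definition up_repr (a : ultrapower) : linfty :=
  repr (a : {eq_quot leqv_equiv}).

Definition up_one : ultrapower := up_class lone.

Definition up_mul (a b : ultrapower) : ultrapower :=
  up_class (lmul (up_repr a) (up_repr b)).

Definition up_star (a : ultrapower) : ultrapower :=
  up_class (lstar (up_repr a)).

Definition up_trace (a : ultrapower) : K[i]^o :=
  lim ((fun n => trace R (up_repr a n) : K[i]^o) @ ufilter omega).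

Definition up_unitary : set ultrapower :=
  [set u | up_mul (up_star u) u = up_one /\ up_mul u (up_star u) = up_one].

End Ultrapower.

Definition hyperlinear (K : realType) (H : hilbert K) (R : II1_factor H)
    (G : groupType) :=
  exists (rho : free_ultrafilter) (theta : G -> ultrapower R rho),
    [/\ forall g, up_unitary (theta g),
        forall g h, theta (g * h)%g = up_mul (theta g) (theta h)
      & forall g, g != 1%g -> up_trace (theta g) = 0].

(* G is the free group on the generators (gen x)_(x : X). *)
Definition free_group_on (X : Type) (G : groupType) (gen : X -> G) :=
  forall (G' : groupType) (f : X -> G'),
    exists! phi : G -> G',
      (forall g h, phi (g * h)%g = (phi g * phi h)%g) /\
      (forall x, phi (gen x) = f x).

(* L is the Hilbert space L^2(R^omega, tau), i.e. the completion of R^omega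
   for <x, y> = tau (y^* x), with canonical map Lambda : R^omega -> L, and pi
   is the action of R^omega by left multiplication.  These data are determined
   up to unitary equivalence. *)
Record standard_representation (K : realType) (H : hilbert K)
    (R : II1_factor H) (omega : free_ultrafilter) (L : hilbert K)
    (Lambda : ultrapower R omega -> L)
    (pi : ultrapower R omega -> L -> L) : Prop := StandardRepresentation {
  std_dotp : forall x y,
    dotp L (Lambda x) (Lambda y) = up_trace (up_mul (up_star y) x);
  std_dense : dense (range Lambda);
  std_bounded : forall x, bounded_op (pi x);
  std_left : forall x y, pi x (Lambda y) = Lambda (up_mul x y) }.

(* Main.v *)
Require Import Defs.
From HB Require Import structures.
From mathcomp Require Import all_boot all_order all_algebra all_fingroup.
From mathcomp Require Import finmap.
From mathcomp Require Import complex ring.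
From mathcomp Require Import all_classical all_reals.
From mathcomp Require Import topology normedtype sequences.
Import Order.TTheory GRing.Theory Num.Theory Num.Def numFieldNormedType.Exports.

Set Implicit Arguments.
Unset Strict Implicit.
Unset Printing Implicit Defensive.

(** Every II_1 factor contains, for each finite group, a copy of its regular
    representation: a group of unitaries indexed by the finite group, all of
    trace 0 except the identity.  Free groups on finitely many generators have
    finite quotients that separate any given ball from 1.  Combining the two
    along an ultrafilter embeds a free group on the points of the Cantor space:
    the n-th coordinate only sees the first n bits of each generator and a
    quotient that is faithful on the ball of radius n.  A given nontrivial
    reduced word involves finitely many generators, which are told apart by
    their first n bits for all large n, so that its image has trace 0 in all
    but finitely many coordinates.

    The regular representations live in the factor because it contains full
    systems of matrix units of every size ([full_mxunits]).  The tools are a polar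
    decomposition ([polar]), obtained as the strong limit of the Newton-Schulz
    iteration v (3 - v^* v) / 2, and an exhaustion principle ([exhaustion]):
    greedily adding orthogonal systems of matrix units, each of at least half
    the largest possible trace, leaves nothing behind, since the traces are
    summable.  Exhaustion applied to a strongly closed two-sided ideal produces
    a central projection, so that in a factor any two nonzero projections are
    linked by a nonzero element ([factor_link]).  A minimal projection would
    then make the factor finite dimensional; hence every nonzero projection
    splits, and linking the two pieces gives two equivalent orthogonal
    projections below it.  Iterating gives any finite number of them
    ([divisible_all]), and exhausting gives matrix units whose diagonal sums
    to 1.

    The ultrapower is handled through the square of the 2-norm.  The only
    estimate that is not formal is that left multiplication by a contraction
    decreases it ([tau_contractive]); it follows from the existence of square
    roots of 1 - x^* x ([sqrt_exists]).

    For the nonseparability, the generators give uncountably many orthonormal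
    vectors of L^2.  By Bessel's inequality a countable set of operators
    sends the vector Lambda 1 into the orthogonal of one of these vectors; the
    unitary that sends Lambda 1 to it is then isolated from the countable set,
    both weakly and strongly. *)

(** * Words and finite quotients of free groups *)

Section Words.
Variable A : eqType.
Local Notation letter := (A * bool)%type.
Implicit Types (l : letter) (w : seq letter).

(** A letter (x, true) stands for the generator x, and (x, false) for its
    inverse. *)
Definition linv l : letter := (l.1, ~~ l.2).

Definition reduced w := sorted (fun l l' => l' != linv l) w.

Lemma reduced_behead l w : reduced (l :: w) -> reduced w.
Proof. exact: path_sorted. Qed.

End Words.

Section Evaluation.
Variables (X : Type) (G : groupType) (f : X -> G).
Local Open Scope group_scope.

Definition leval (l : X * bool) : G := if l.2 then f l.1 else (f l.1)^-1.

(** The first letter is the rightmost factor.  Permutations compose on the right,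
    so that the permutation of a word a :: w first lets w act and then a, as a
    word grows by putting letters in front of it. *)
Fixpoint weval (w : seq (X * bool)) : G :=
  if w is l :: w' then weval w' * leval l else 1.

Lemma weval_cat u v : weval (u ++ v) = weval v * weval u.
Proof. by elim: u => [|l u IHu] /=; rewrite ?mulg1 // IHu mulgA. Qed.

Definition winv (w : seq (X * bool)) := rev [seq (l.1, ~~ l.2) | l <- w].

Lemma weval_inv w : weval (winv w) = (weval w)^-1.
Proof.
rewrite /winv; elim: w => [|l w IHw] /=; first by rewrite invg1.
rewrite rev_cons -cats1 weval_cat IHw /= mul1g invgM; congr (_ * _).
by case: l => x []; rewrite /leval /= ?invgK.
Qed.

End Evaluation.

Lemma weval_map (X Y : Type) (G : groupType) (f : Y -> G) (h : X -> Y) w :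
  weval f [seq (h l.1, l.2) | l <- w] = weval (f \o h) w.
Proof. by elim: w => //= l w ->. Qed.

Lemma weval_morph (X : Type) (G G' : groupType) (f : X -> G) (phi : G -> G') w :
  (forall g h, phi (g * h)%g = (phi g * phi h)%g) ->
  phi (weval f w) = weval (phi \o f) w.
Proof.
move=> phiM; have phi1 : phi 1%g = 1%g.
  by apply: (mulgI (phi 1%g)); rewrite -phiM !mulg1.
have phiV g : phi (g^-1)%g = ((phi g)^-1)%g.
  by apply: (mulgI (phi g)); rewrite -phiM !mulgV.
elim: w => //= l w IHw; rewrite phiM IHw; congr (_ * _)%g.
by case: l => x []; rewrite /leval /= ?phiV.
Qed.

(** Putting a letter in front of a reduced word either leaves it reduced or
    cancels its head. *)
Lemma weval_reduced (X : eqType) (G : groupType) (f : X -> G) w :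
  exists2 w', reduced w' & weval f w' = weval f w.
Proof.
elim: w => [|l w [w' rw' ew']]; first by exists [::].
case: w' => [|l' u] in rw' ew' *; first by exists [:: l] => //=; rewrite -ew'.
have [ll'|ll'] := eqVneq l' (linv l); last first.
  by exists (l :: l' :: u); rewrite /= ?ll' // -ew'.
exists u; first exact: reduced_behead rw'.
rewrite /= -ew' /= ll' -mulgA; case: (l) => x [];
  by rewrite /leval /= ?mulgV ?mulVg mulg1.
Qed.

(** One point at a time: a permutation that already agrees with f on s is
    corrected at a by the transposition of its value at a and f a, which moves no
    value taken on s. *)
Lemma perm_extension (T : finType) (s : seq T) (f : T -> T) :
  {in s &, injective f} -> exists p : {perm T}, {in s, p =1 f}.
Proof.
elim: s => [|a s IHs] fi; first by exists 1%g.
have [|p pf] := IHs.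
  by move=> x y xs ys; apply: fi; rewrite inE ?xs ?ys orbT.
have [as_|as_] := boolP (a \in s).
  by exists p => x; rewrite inE => /predU1P[->|]; exact: pf.
exists (p * tperm (p a) (f a))%g => x; rewrite inE permM.
have [-> _|xa /= xs] := eqVneq x a; first by rewrite tpermL.
rewrite -(pf _ xs) tpermD // ?(inj_eq perm_inj) 1?eq_sym //.
rewrite pf //; apply: contra xa => /eqP fx; apply/eqP.
by apply: fi => //; rewrite inE ?eqxx ?xs ?orbT.
Qed.

Section Ball.
Variables (A : finType) (n : nat).
Local Notation letter := (A * bool)%type.
Implicit Types (l : letter) (w : seq letter).

(** Left multiplication of a reduced word by the generator a, in the free group *)
Definition push (a : A) w : seq letter :=
  if w is l :: w' then if l == (a, false) then w' else (a, true) :: w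
  else [:: (a, true)].

(** Left multiplication is injective in the free group; on words that are not
    reduced it is not, since (a, false) :: (a, true) :: w is sent to the same word
    as w. *)
Lemma push_inj a : {in @reduced A &, injective (push a)}.
Proof.
move=> u v; rewrite !unfold_in.
have aux l w : reduced (l :: w) -> l = (a, false) -> forall w', w != (a, true) :: w'.
  move=> + la w'; rewrite la; apply: contraTneq => -> /=.
  by rewrite /linv /= eqxx.
case: u v => [|l u] [|k v] //= rl rk.
- case: eqP => ka; last (by case).
  by move=> vE; have := aux _ _ rk ka [::]; rewrite -vE eqxx.
- case: eqP => la; last (by case).
  by move=> uE; have := aux _ _ rl la [::]; rewrite uE eqxx.
case: eqP => la; case: eqP => ka; last by move=> [-> ->].
- by move=> ->; rewrite la ka.
- by move=> uE; have := aux _ _ rl la (k :: v); rewrite uE eqxx.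
- by move=> vE; have := aux _ _ rk ka (l :: u); rewrite -vE eqxx.
Qed.

Lemma push_perm (a : A) : exists p : {perm {bseq n of letter}},
  forall u : {bseq n of letter}, reduced u -> (size (push a u) <= n)%N ->
    bseqval (p u) = push a u.
Proof.
pose f (u : {bseq n of letter}) := insub_bseq n (push a u).
pose D := seq.filter
  (fun u : {bseq n of letter} => reduced u && (size (push a u) <= n)%N)
  (enum {: {bseq n of letter}}).
have fE (u : {bseq n of letter}) : (size (push a u) <= n)%N -> bseqval (f u) = push a u.
  by move=> su; rewrite /f /insub_bseq insubdK.
have [|p pf] := @perm_extension _ D f.
  move=> u v; rewrite !mem_filter => /andP[/andP[ru su] _] /andP[/andP[rv sv] _].
  move=> /(congr1 (@bseqval _ _)); rewrite !fE // => uv; have {}uv := push_inj ru rv uv.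
  exact: val_inj.
exists p => u ru su; rewrite pf ?fE //.
by rewrite mem_filter ru su mem_enum.
Qed.

(** Each generator acts on the ball of radius n of the Cayley graph by left
    multiplication, as long as it stays inside the ball; this partial injection
    extends to a permutation of the ball.  A reduced word of length at most n then
    moves the empty word to the point of the ball that it spells, so it acts
    trivially only if it is empty. *)
Lemma finite_quotient : exists (gT : finGroupType) (s : A -> gT),
  forall w, reduced w -> (size w <= n)%N -> weval s w = 1%g -> w = [::].
Proof.
have [s sP] := boolp.choice push_perm.
exists {perm {bseq n of letter}}, s => w rw sw w1.
suff h : forall w, reduced w -> (size w <= n)%N ->
    bseqval ((weval s w : {perm {bseq n of letter}}) [bseq]) = w.
  by rewrite -(h w rw sw) w1 perm1.
elim=> {w rw sw w1} [|l w IHw] rw sw; first by rewrite perm1.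
have rw' := reduced_behead rw; have sw' := ltnW sw.
have {IHw} := IHw rw' sw'; rewrite /= permM.
set u := (weval s w : {perm {bseq n of letter}}) [bseq] => uw.
case: l rw sw => a [] rw sw; rewrite /leval /=.
  have pw : push a u = (a, true) :: w.
    rewrite uw; case: (w) rw => [//|k v] /=.
    by rewrite {1}/linv /= => /andP[/negPf-> _].
  by rewrite sP ?pw // uw.
pose v : {bseq n of letter} := Bseq (sw : (size ((a, false) :: w) <= n)%N).
have -> : u = s a v.
  by apply: val_inj; rewrite /= sP /= ?eqxx //; rewrite uw.
by rewrite permK.
Qed.

End Ball.

(** * Generators of a free group *)

Section Span.
Variables (X : Type) (G : groupType) (gen : X -> G).
Local Open Scope group_scope.

(** The subgroup generated by the family gen *)
Definition wspan := {g : G | `[< exists w, weval gen w = g >]}.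
HB.instance Definition _ := Choice.on wspan.

Fact wspan1_subproof : `[< exists w, weval gen w = 1 >].
Proof. by apply/asboolP; exists [::]. Qed.
Fact wspanM_subproof (a b : wspan) : `[< exists w, weval gen w = val a * val b >].
Proof.
have /asboolP[u ua] := valP a; have /asboolP[v vb] := valP b; apply/asboolP.
by exists (v ++ u); rewrite weval_cat ua vb.
Qed.
Fact wspanV_subproof (a : wspan) : `[< exists w, weval gen w = (val a)^-1 >].
Proof.
have /asboolP[u ua] := valP a; apply/asboolP.
by exists (winv u); rewrite weval_inv ua.
Qed.
Definition wspan1 : wspan := exist _ 1 wspan1_subproof.
Definition wspanM a b : wspan := exist _ (val a * val b) (wspanM_subproof a b).
Definition wspanV a : wspan := exist _ ((val a)^-1) (wspanV_subproof a).
Fact wspanA : associative wspanM.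
Proof. by move=> a b c; apply: val_inj; rewrite /= mulgA. Qed.
Fact wspan1M : left_id wspan1 wspanM.
Proof. by move=> a; apply: val_inj; rewrite /= mul1g. Qed.
Fact wspanM1 : right_id wspan1 wspanM.
Proof. by move=> a; apply: val_inj; rewrite /= mulg1. Qed.
Fact wspanVM : left_inverse wspan1 wspanV wspanM.
Proof. by move=> a; apply: val_inj; rewrite /= mulVg. Qed.
Fact wspanMV : right_inverse wspan1 wspanV wspanM.
Proof. by move=> a; apply: val_inj; rewrite /= mulgV. Qed.
HB.instance Definition _ :=
  isGroup.Build wspan wspanA wspan1M wspanM1 wspanVM wspanMV.

(** The universal property gives a retraction of G onto the subgroup generated by
    gen; by uniqueness its composition with the inclusion is the identity. *)
Lemma free_generated : free_group_on gen -> forall g, exists w, weval gen w = g.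
Proof.
move=> fr g.
have genS x : `[< exists w, weval gen w = gen x >].
  by apply/asboolP; exists [:: (x, true)]; rewrite /= mul1g.
have [phi [[phiM phig] _]] := fr wspan (fun x => exist _ (gen x) (genS x)).
have [psi [_ psiU]] := fr G gen.
have h1 : psi = id by apply: psiU.
have h2 : psi = (fun g => val (phi g)).
  apply: psiU; split=> [a b|x]; first by rewrite phiM.
  by rewrite phig.
have -> : g = val (phi g) by rewrite -[LHS]/(id g) -h1 h2.
by apply/asboolP; exact: (valP (phi g)).
Qed.

End Span.

Local Open Scope classical_set_scope.
Local Open Scope ring_scope.

(** * The algebra of operators *)

(** Elements of the factor are bundled with their membership proof, so that
    composition makes them a ring with the usual algebraic notation. *)
Record vnop (K : realType) (H : hilbert K) (R : II1_factor H) := VnOp {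
  op_fun :> H -> H;
  op_mem : carrier R op_fun }.

Section OperatorAlgebra.
Variables (K : realType) (H : hilbert K) (R : II1_factor H).
Local Notation M := (vnop R).
Local Notation C := K[i].
Let As : star_algebra (carrier R) := vn_star (II1_vn R).

HB.instance Definition _ := gen_eqMixin M.
HB.instance Definition _ := gen_choiceMixin M.

Lemma op_eq (x y : M) : (forall v, x v = y v) -> x = y.
Proof.
case: x y => [x Ax] [y Ay] /= /funext xy.
by rewrite {x}xy in Ax *; congr VnOp; exact: Prop_irrelevance.
Qed.

Definition op_zero : M := VnOp (star_zero As).
Definition op_opp (x : M) : M := VnOp (star_opp As (op_mem x)).
Definition op_add (x y : M) : M := VnOp (star_add As (op_mem x) (op_mem y)).
Definition op_one : M := VnOp (vn_one (II1_vn R)).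
Definition op_mul (x y : M) : M := VnOp (star_mul As (op_mem x) (op_mem y)).
Fact op_scale_mem (c : C) (x : M) : carrier R (c *: (x : H -> H)).
Proof.
have := star_linear As c (op_mem x) (star_zero As).
by rewrite addr0.
Qed.
Definition op_scale (c : C) (x : M) : M := VnOp (op_scale_mem c x).

Fact op_addA : associative op_add.
Proof. by move=> x y z; apply: op_eq => v; exact: addrA. Qed.
Fact op_addC : commutative op_add.
Proof. by move=> x y; apply: op_eq => v; exact: addrC. Qed.
Fact op_add0 : left_id op_zero op_add.
Proof. by move=> x; apply: op_eq => v; exact: add0r. Qed.
Fact op_addN : left_inverse op_zero op_opp op_add.
Proof. by move=> x; apply: op_eq => v; exact: addNr. Qed.

HB.instance Definition _ :=
  GRing.isZmodule.Build M op_addA op_addC op_add0 op_addN.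

Lemma opD (x y : M) v : (x + y) v = x v + y v. Proof. by []. Qed.
Lemma opN (x : M) v : (- x) v = - x v. Proof. by []. Qed.
Lemma opB (x y : M) v : (x - y) v = x v - y v. Proof. by []. Qed.
Lemma op0 v : (0 : M) v = 0. Proof. by []. Qed.

Lemma op_vecD (x : M) u v : x (u + v) = x u + x v.
Proof. by have h := star_additive As u v (op_mem x); exact: h. Qed.

Lemma op_vecZ (x : M) c v : x (c *: v) = c *: x v.
Proof.
case: (star_bounded As (op_mem x)) => xl _.
by have := xl c v 0; rewrite (star_at0 As (op_mem x)) !addr0.
Qed.

Lemma op_vecN (x : M) v : x (- v) = - x v.
Proof. by have h := star_atN As v (op_mem x); exact: h. Qed.

Lemma op_vec0 (x : M) : x 0 = 0.
Proof. by have h := star_at0 As (op_mem x); exact: h. Qed.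

Fact op_mulA : associative op_mul.
Proof. by move=> x y z; apply: op_eq. Qed.
Fact op_mul1 : left_id op_one op_mul.
Proof. by move=> x; apply: op_eq. Qed.
Fact op_mulr1 : right_id op_one op_mul.
Proof. by move=> x; apply: op_eq. Qed.
Fact op_mulDl : left_distributive op_mul +%R.
Proof. by move=> x y z; apply: op_eq. Qed.
Fact op_mulDr : right_distributive op_mul +%R.
Proof. by move=> x y z; apply: op_eq => v; exact: op_vecD. Qed.
Lemma tau0 : trace R (0 : M) = 0.
Proof.
have T := II1_tracial R.
have := tr_linear T 1 (star_zero As) (star_zero As).
rewrite scale1r mul1r addr0 => h.
by apply: (addrI (trace R 0)); rewrite addr0 -h.
Qed.
Fact op_one_neq0 : op_one != 0.
Proof.
apply/eqP => h; have := tr_one (II1_tracial R).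
have -> : trace R id = trace R (op_one : M) by [].
by rewrite h tau0 => /esym /eqP; rewrite oner_eq0.
Qed.
HB.instance Definition _ := GRing.Zmodule_isNzRing.Build M
  op_mulA op_mul1 op_mulr1 op_mulDl op_mulDr op_one_neq0.

Lemma opM (x y : M) v : (x * y) v = x (y v). Proof. by []. Qed.
Lemma op1 v : (1 : M) v = v. Proof. by []. Qed.

Fact op_scaleA a b x : op_scale a (op_scale b x) = op_scale (a * b) x.
Proof. by apply: op_eq => v; exact: scalerA. Qed.
Fact op_scale1 : left_id 1 op_scale.
Proof. by move=> x; apply: op_eq => v; exact: scale1r. Qed.
Fact op_scaleDr : right_distributive op_scale +%R.
Proof. by move=> c x y; apply: op_eq => v; exact: scalerDr. Qed.
Fact op_scaleDl x : {morph op_scale^~ x : a b / a + b}.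
Proof. by move=> a b; apply: op_eq => v; exact: scalerDl. Qed.
HB.instance Definition _ := GRing.Zmodule_isLmodule.Build C M
  op_scaleA op_scale1 op_scaleDr op_scaleDl.

Lemma opZ c (x : M) v : (c *: x) v = c *: x v. Proof. by []. Qed.

Fact op_scaleAl (c : C) (x y : M) : c *: (x * y) = (c *: x) * y.
Proof. by apply: op_eq. Qed.
HB.instance Definition _ := GRing.Lmodule_isLalgebra.Build C M op_scaleAl.
Fact op_scaleAr (c : C) (x y : M) : c *: (x * y) = x * (c *: y).
Proof. by apply: op_eq => v; rewrite opM opZ opM op_vecZ. Qed.
HB.instance Definition _ := GRing.Lalgebra_isAlgebra.Build C M op_scaleAr.

Definition star (x : M) : M := VnOp (adj_mem As (op_mem x)).

Local Notation "''<' x , y >" := (dotp H x y).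

Lemma starP (x : M) u v : '<x u, v> = '<u, star x v>.
Proof. exact: (adjP As (op_mem x)). Qed.

Lemma star_def (x y : M) : (forall u v, '<x u, v> = '<u, y v>) -> star x = y.
Proof.
by move=> xy; apply: op_eq => v; apply: dotp_injr => u; rewrite -starP xy.
Qed.

Lemma starPr (x : M) u v : '<u, x v> = '<star x u, v>.
Proof. by rewrite dotpC starP -dotpC. Qed.

Lemma starK x : star (star x) = x.
Proof. by apply: star_def => u v; rewrite -starPr. Qed.
Lemma starD x y : star (x + y) = star x + star y.
Proof. by apply: star_def => u v; rewrite dotpDl !starP -dotpDr. Qed.
Lemma starZ c x : star (c *: x) = conjC c *: star x.
Proof. by apply: star_def => u v; rewrite dotpZl starP dotpZr conjCK. Qed.
Lemma starM x y : star (x * y) = star y * star x.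
Proof. by apply: star_def => u v; rewrite opM !starP. Qed.
Lemma star1 : star 1 = 1.
Proof. exact: star_def. Qed.
Lemma starN x : star (- x) = - star x.
Proof. by rewrite -scaleN1r starZ rmorphN1 scaleN1r. Qed.
Lemma starB x y : star (x - y) = star x - star y.
Proof. by rewrite starD starN. Qed.
Lemma star0 : star 0 = 0.
Proof. by rewrite -[0 in LHS](subrr (0 : M)) starB subrr. Qed.
Lemma star_sum I (r : seq I) (P : pred I) (F : I -> M) :
  star (\sum_(i <- r | P i) F i) = \sum_(i <- r | P i) star (F i).
Proof. by apply: (big_morph star starD star0). Qed.

Lemma dotp0l u : '<0, u> = 0.
Proof. by rewrite -(scale0r (0 : H)) dotpZl mul0r. Qed.

Lemma dot_starM (x : M) v : '<(star x * x) v, v> = `|x v| ^+ 2.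
Proof. by rewrite opM -starPr dotpE. Qed.

Lemma star_mul_eq0 (x : M) : star x * x = 0 -> x = 0.
Proof.
move=> h; apply: op_eq => v; apply/eqP.
by rewrite -normr_eq0 -sqrf_eq0 -dot_starM h op0 dotp0l.
Qed.

(** * The trace *)

Definition tau (x : M) : C := trace R x.

Lemma tauD x y : tau (x + y) = tau x + tau y.
Proof.
have := tr_linear (II1_tracial R) 1 (op_mem x) (op_mem y).
by rewrite scale1r mul1r.
Qed.
Lemma tauZ c x : tau (c *: x) = c * tau x.
Proof.
have := tr_linear (II1_tracial R) c (op_mem x) (star_zero As).
by rewrite addr0 (tau0 : trace R 0 = 0) addr0.
Qed.
Lemma tauN x : tau (- x) = - tau x.
Proof. by rewrite -scaleN1r tauZ mulN1r. Qed.
Lemma tauB x y : tau (x - y) = tau x - tau y.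
Proof. by rewrite tauD tauN. Qed.
Lemma tau_sum I (r : seq I) (P : pred I) (F : I -> M) :
  tau (\sum_(i <- r | P i) F i) = \sum_(i <- r | P i) tau (F i).
Proof. by apply: (big_morph tau tauD tau0). Qed.
Lemma tau1 : tau 1 = 1.
Proof. exact: tr_one (II1_tracial R). Qed.
Lemma tauC x y : tau (x * y) = tau (y * x).
Proof. by have h := tr_comm (II1_tracial R) (op_mem x) (op_mem y); exact: h. Qed.
Lemma tau_ge0 x : 0 <= tau (star x * x).
Proof. by have h := tr_ge0 (II1_tracial R) (op_mem x); exact: h. Qed.
Lemma tau_faithful x : tau (star x * x) = 0 -> x = 0.
Proof.
move=> h; have e := II1_faithful (op_mem x) h.
by apply: op_eq => v; rewrite e.
Qed.

(** * Contractions and strong limits *)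

Definition contractive (x : M) := forall v, `|x v| <= `|v|.

Definition strong_lim (u : nat -> M) (x : M) :=
  forall v, (u n v) @[n --> \oo] --> x v.

End OperatorAlgebra.

Lemma cvgC_unique (K : realType) (T : Type) (F : set_system T)
    {FF : ProperFilter F} (f : T -> K[i]) (l l' : K[i]) :
  f @ F --> (l : K[i]^o) -> f @ F --> (l' : K[i]^o) -> l = l'.
Proof.
move=> fl fl'; have h := @cvg_unique _ (@norm_hausdorff _ (K[i]^o))
  (f @ F) _ l l' fl fl'.
exact: h.
Qed.

(** A limit of nonnegative complex numbers is the limit of their moduli. *)
Lemma cvg_ge0 (K : realType) (T : Type) (F : set_system T)
    {FF : ProperFilter F} (f : T -> K[i]) (l : K[i]) :
  (f @ F --> (l : K[i]^o)) -> (forall t, 0 <= f t) -> 0 <= l.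
Proof.
move=> fl f0; suff -> : l = `|l| by [].
have fn : (fun t => `|f t|) = f.
  by apply/funext => t; rewrite ger0_norm.
have fl' : (fun t => `|f t|) @ F --> (`|l| : K[i]^o).
  have FF' : Filter F := @filter_filter _ _ FF.
  apply/(cvgrPdist_lt (V := K[i]^o)) => e e0.
  have := (cvgrPdist_lt (FF := FF') (V := K[i]^o) _ _).1 fl e e0.
  by apply: filterS => t; apply: le_lt_trans; exact: ler_dist_dist.
rewrite fn in fl'.
have h := @cvgC_unique _ _ F _ f l `|l| fl fl'.
exact: h.
Qed.

(** The bounded monotone sequence c converges, so its increments are eventually
    small, and they dominate those of u. *)
Lemma cvgn_of_monotone (K : realType) (V : completeNormedModType K[i])
    (u : nat -> V) (c : nat -> K[i]) (B : K[i]) :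
  (forall n m, (n <= m)%N -> `|u m - u n| ^+ 2 <= c m - c n) ->
  (forall n, 0 <= c n) -> (forall n, c n <= B) -> cvgn u.
Proof.
move=> uc c0 cB; apply/cauchy_cvgP/cauchy_exP => e e0 /=.
have e20 : 0 < e ^+ 2 by rewrite exprn_gt0.
pose d n : K := complex.Re (c n).
have cE n : c n = (d n)%:C%C.
  by have := c0 n; rewrite /d; case: (c n) => a b; rewrite lecE /= => /andP[/eqP-> _].
have dnd n m : (n <= m)%N -> d n <= d m.
  move=> nm; have := le_trans (exprn_ge0 2 (normr_ge0 _)) (uc _ _ nm).
  by rewrite subr_ge0 !cE lecR.
have hs : has_sup (range d).
  split; first by exists (d 0%N), 0%N.
  exists (complex.Re B) => _ [n _ <-].
  by have := cB n; rewrite cE; case: B {cB} => a b; rewrite lecE /= => /andP[].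
pose r : K := complex.Re (e ^+ 2).
have eE : e ^+ 2 = r%:C%C.
  by move: e20; rewrite /r; case: (e ^+ 2) => a b; rewrite ltcE /= => /andP[/eqP-> _].
have r0 : 0 < r by move: e20; rewrite eE ltcR.
have [_ [N _ <-] dN] := sup_adherent r0 hs.
exists (u N), N => // m /= Nm.
rewrite -ball_normE /= distrC -(@ltr_pXn2r _ 2) ?nnegrE ?(ltW e0)//.
apply: le_lt_trans (uc _ _ Nm) _; rewrite !cE eE -rmorphB ltcR.
rewrite ltrBlDr -ltrBlDl; apply: le_lt_trans dN; rewrite lerD2r.
by apply: ub_le_sup; [case: hs|exists m].
Qed.

Section Limits.
Variables (K : realType) (H : hilbert K) (R : II1_factor H).
Local Notation M := (vnop R).
Local Notation C := K[i].
Local Notation "''<' x , y >" := (dotp H x y).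
Implicit Types (x y z : M) (u w : nat -> M) (c : C).

Lemma dot_cvgl (T : Type) (F : set_system T) {FF : Filter F}
    (f : T -> H) (a b : H) :
  (f @ F --> a) -> (fun t => '<f t, b>) @ F --> ('<a, b> : C^o).
Proof.
move=> fa; apply/(cvgrPdist_lt (V := C^o)) => e e0.
have w0 : 0 < `|b| + 1 by rewrite ltr_wpDl.
have := (cvgrPdist_lt (FF := FF) _ _).1 fa (e / (`|b| + 1)) (divr_gt0 e0 w0).
apply: filterS => t; rewrite ltr_pdivlMr // => h.
rewrite -dotpNl -dotpDl; apply: le_lt_trans h.
by apply: le_trans (dotp_cauchy_schwarz _ _) _; rewrite ler_wpM2l // lerDl.
Qed.
Arguments dot_cvgl {T F FF f a} b _.

Lemma dot_cvgr (T : Type) (F : set_system T) {FF : Filter F}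
    (f : T -> H) (a b : H) :
  (f @ F --> a) -> (fun t => '<b, f t>) @ F --> ('<b, a> : C^o).
Proof.
move=> /(dot_cvgl b) h; apply/(cvgrPdist_lt (V := C^o)) => e e0.
have := (cvgrPdist_lt (FF := FF) (V := C^o) _ _).1 h e e0.
by apply: filterS => t; rewrite (dotpC b a) (dotpC b (f t)) -rmorphB norm_conjC.
Qed.
Arguments dot_cvgr {T F FF f a} b _.

Lemma dot_cvg (T : Type) (F : set_system T) {FF : Filter F}
    (f g : T -> H) (a b : H) (B : C) : 0 < B -> (forall t, `|g t| <= B) ->
  (f @ F --> a) -> (g @ F --> b) ->
  (fun t => '<f t, g t>) @ F --> ('<a, b> : C^o).
Proof.
move=> B0 gB fa gb.
have -> : (fun t => '<f t, g t>) = (fun t => '<f t - a, g t> + '<a, g t>).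
  by apply/funext => t; rewrite -dotpDl subrK.
rewrite -[ '<a, b> ]add0r; apply: (@cvgD _ C^o); last exact: dot_cvgr.
apply/(cvgr0Pnorm_lt (V := C^o)) => e e0.
have := (cvgrPdist_lt (FF := FF) _ _).1 fa (e / B) (divr_gt0 e0 B0).
apply: filterS => t; rewrite ltr_pdivlMr // distrC; apply: le_lt_trans.
by apply: le_trans (dotp_cauchy_schwarz _ _) _; rewrite ler_wpM2l.
Qed.

Lemma op_continuous (x : M) : continuous x.
Proof. by case: (star_bounded (vn_star (II1_vn R)) (op_mem x)). Qed.

Lemma op_linear (x : M) : linear x.
Proof. by case: (star_bounded (vn_star (II1_vn R)) (op_mem x)). Qed.

Lemma op_bounded (x : M) : exists2 c : C, 0 < c & forall v, `|x v| <= c * `|v|.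
Proof.
pose f : {linear H -> H} := HB.pack (x : H -> H)
  (GRing.isLinear.Build _ _ _ _ (x : H -> H) (op_linear x)).
have := (linear_bounded_continuous f).2 (@op_continuous x).
move/linear_boundedP => h.
have [c [c0 hc]] : exists c : C, 0 < c /\ forall v, `|x v| <= c * `|v|.
  near (+oo_C) => r; exists r; split; last by near: r; exact: h.
  by near: r; apply: nbhs_pinfty_gt; exact: real0.
by exists c.
Unshelve. all: by end_near. Qed.

Lemma strong_lim_unique (u : nat -> M) x y :
  strong_lim u x -> strong_lim u y -> x = y.
Proof.
move=> ux uy; apply: op_eq => v.
exact: (@cvg_unique _ (@norm_hausdorff _ H) _ _ _ _ (ux v) (uy v)).
Qed.

Lemma strong_lim_cst x : strong_lim (fun=> x) x.
Proof. by move=> v; exact: cvg_cst. Qed.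

Lemma strong_limD u w x y : strong_lim u x -> strong_lim w y ->
  strong_lim (fun n => u n + w n) (x + y).
Proof. by move=> ux wy v; apply: (@cvgD _ _ _ \oo _ _ _ _ _ (ux v) (wy v)). Qed.

Lemma strong_limMl z u x : strong_lim u x -> strong_lim (fun n => z * u n) (z * x).
Proof.
move=> ux v; rewrite opM.
by apply: (@continuous_cvg _ _ _ \oo _ _ _ _ (@op_continuous z _) (ux v)).
Qed.

Lemma strong_limMr z u x : strong_lim u x -> strong_lim (fun n => u n * z) (x * z).
Proof. by move=> ux v; exact: ux. Qed.

Lemma strong_limZ c u x : strong_lim u x -> strong_lim (fun n => c *: u n) (c *: x).
Proof. by move=> ux v; rewrite opZ; apply: (@cvgZr _ _ _ _ _ _ _ _ (ux v)). Qed.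

Lemma strong_limN u x : strong_lim u x -> strong_lim (fun n => - u n) (- x).
Proof. by move=> ux v; rewrite opN; apply: (@cvgN _ _ _ _ _ _ _ (ux v)). Qed.

(** Multiplication is strongly continuous on bounded sets only: the error of the
    second factor is transported by u n. *)
Lemma strong_limM u w x y : (forall n, contractive (u n)) ->
  strong_lim u x -> strong_lim w y -> strong_lim (fun n => u n * w n) (x * y).
Proof.
move=> uc ux wy v.
have -> : (fun n => (u n * w n : M) v : H) = (fun n => u n (w n v - y v) + u n (y v)).
  by apply/funext => n; rewrite -op_vecD subrK.
rewrite opM -[x (y v)]add0r; apply: (@cvgD _ _ _ \oo); last exact: ux.
apply/cvgr0Pnorm_lt => e e0.
have /cvgrPdist_lt /(_ e e0) := wy v.
apply: filterS => n; rewrite distrC; apply: le_lt_trans; exact: uc.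
Qed.

Lemma strong_lim_star u w x y : (forall n, star (u n) = w n) ->
  strong_lim u x -> strong_lim w y -> star x = y.
Proof.
move=> uw ux wy; apply: star_def => a b.
have h1 : (fun n => '<u n a, b>) @ \oo --> ('<x a, b> : C^o).
  exact: (dot_cvgl b (ux a)).
have h2 : (fun n => '<a, w n b>) @ \oo --> ('<a, y b> : C^o).
  exact: (dot_cvgr a (wy b)).
have e : (fun n => '<u n a, b>) = (fun n => '<a, w n b>).
  by apply/funext => n; rewrite starP uw.
rewrite e in h1; exact: (cvgC_unique h1 h2).
Qed.

(** The pointwise limit is bounded, and it is a weak operator limit of elements of
    the von Neumann algebra. *)
Lemma strong_lim_exists (u : nat -> M) : (forall n, contractive (u n)) ->
  (forall v, cvgn (fun n => u n v)) -> exists x, strong_lim u x.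
Proof.
move=> uc ucv; pose T v := limn (fun n => u n v).
have uT v : (fun n => u n v) @ \oo --> T v by exact: ucv.
have Tlin : linear T.
  move=> c a b; apply/esym.
  have h1 : (fun n => c *: u n a + u n b) @ \oo --> c *: T a + T b.
    by apply: (@cvgD _ _ _ \oo); [apply: cvgZr|]; exact: uT.
  have e : (fun n => c *: u n a + u n b) = (fun n => u n (c *: a + b)).
    by apply/funext => n; rewrite op_vecD op_vecZ.
  rewrite e in h1.
  exact: (@cvg_unique _ (@norm_hausdorff _ H) _ _ _ _ h1 (uT _)).
have Tc v : `|T v| <= `|v|.
  rewrite -subr_ge0.
  have h : (fun n => `|u n v|) @ \oo --> (`|T v| : C^o) by exact: (cvg_norm (uT v)).
  have h2 : (fun n => `|v| - `|u n v|) @ \oo --> (`|v| - `|T v| : C^o).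
    by apply: (@cvgB _ C^o); [exact: cvg_cst|exact: h].
  by apply: (cvg_ge0 h2) => n; rewrite subr_ge0; exact: uc.
have Tb : bounded_op T.
  split => //.
  pose f : {linear H -> H} := HB.pack T (GRing.isLinear.Build _ _ _ _ T Tlin).
  apply: (bounded_linear_continuous (f := f)); apply/linear_boundedP.
  exists 1; split; first exact: real1.
  by move=> r r1 v; apply: le_trans (Tc v) _; rewrite ler_peMl // ltW.
have Tw : wot_closure (carrier R) T.
  rewrite /wot_closure /= => B HB.
  have : (fun n => mcoef (u n)) @ \oo --> (mcoef T : {ptws (H * H) -> C^o}).
    apply/pointwise_cvgP => p; exact: (dot_cvgl p.2 (uT p.1)).
  move=> /(_ B HB) [N _ hN].
  exists (mcoef (u N)); split; last by apply: hN => /=.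
  by exists (u N : H -> H) => //; exact: op_mem.
by exists (VnOp (vn_closed (II1_vn R) (conj Tw Tb))).
Qed.

End Limits.

(** * Polynomials that are nonnegative on [0, 1] *)

Section Cone.
Variable K : realType.
Local Notation C := K[i].
Implicit Types p q : {poly C}.

(** Polynomials whose nonnegativity on [0, 1] survives the substitution of an
    operator a with 0 <= a <= 1 for the variable.  As they are closed under
    products, operator inequalities reduce to identities in a commutative ring. *)
Inductive cone : {poly C} -> Prop :=
| cone_monomial c i j : 0 <= c -> cone (c *: ('X^i * (1 - 'X) ^+ j))
| cone_add p q : cone p -> cone q -> cone (p + q).

Lemma cone_mul p q : cone p -> cone q -> cone (p * q).
Proof.
elim=> {p} [c i j c0|p p' _ IHp _ IHp' cq]; last first.
  by rewrite mulrDl; apply: cone_add; [apply: IHp|apply: IHp'].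
elim=> {q} [d k l d0|q q' _ IHq _ IHq']; last by rewrite mulrDr; apply: cone_add.
rewrite -scalerAl -scalerAr scalerA mulrACA -!exprD.
by apply: cone_monomial; rewrite mulr_ge0.
Qed.

Lemma cone0 : cone 0.
Proof. by have := cone_monomial 0 0 (lexx (0 : C)); rewrite scale0r. Qed.

Lemma cone1 : cone 1.
Proof.
by have := cone_monomial 0 0 (@ler01 C); rewrite !expr0 mulr1 scale1r.
Qed.

Lemma coneX : cone 'X.
Proof.
by have := cone_monomial 1 0 (@ler01 C); rewrite expr0 mulr1 scale1r.
Qed.

Lemma coneBX : cone (1 - 'X).
Proof.
by have := cone_monomial 0 1 (@ler01 C); rewrite expr0 mul1r expr1 scale1r.
Qed.

Lemma cone_exp p n : cone p -> cone (p ^+ n).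
Proof.
by move=> cp; elim: n => [|n IHn]; rewrite ?exprS; [exact: cone1|exact: cone_mul].
Qed.

(** The constant 1/2.  The identities of the two iterations only depend on
    phalf + phalf = 1. *)
Definition phalf : {poly C} := 2^-1%:P.

Lemma cone_phalf : cone phalf.
Proof.
have h : (0 : C) <= 2^-1 by rewrite invr_ge0 ler0n.
by have := cone_monomial 0 0 h; rewrite !expr0 mulr1 alg_polyC.
Qed.

Lemma phalfD : phalf + phalf = 1.
Proof.
rewrite /phalf -polyCD; congr polyC.
by rewrite [RHS](splitr 1) mul1r.
Qed.

(** Newton-Schulz iteration for t^(-1/2): for t in (0, 1], t * (newton k) ^ 2
    increases to 1. *)
Fixpoint newton k : {poly C} :=
  if k is k'.+1 then newton k' * (1 + phalf * (1 - 'X * newton k' ^+ 2)) else 1.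

Lemma newton_step (S : comNzRingType) (h q : S) : h + h = 1 ->
  1 - (1 - q) * (1 + h * q) ^+ 2 = h * h * q ^+ 2 * (1 + 1 + 1 + q).
Proof.
move=> hh.
(* the two sides differ by a multiple of 1 - (h + h) *)
transitivity (h * h * q ^+ 2 * (1 + 1 + 1 + q)
              + (1 - (h + h)) * (q + (h + h) * q ^+ 2)); first by ring.
by rewrite hh subrr mul0r addr0.
Qed.

Lemma newton_cone k : cone (newton k) /\ cone (1 - 'X * newton k ^+ 2).
Proof.
elim: k => [|k [cg cp]] /=.
  by rewrite expr1n mulr1; split; [exact: cone1|exact: coneBX].
set q := 1 - 'X * newton k ^+ 2 in cp *.
have c1 := cone1; have ch := cone_phalf.
split; first by apply: cone_mul => //; apply: cone_add => //; apply: cone_mul.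
have -> : 'X * (newton k * (1 + phalf * q)) ^+ 2 = (1 - q) * (1 + phalf * q) ^+ 2.
  by rewrite /q; ring.
rewrite newton_step ?phalfD //.
by repeat (apply: cone_mul || apply: cone_add || apply: cone_exp) => //.
Qed.

Lemma newton_mono n m : (n <= m)%N -> cone (newton m - newton n).
Proof.
move=> nm; rewrite -(subnK nm); elim: (m - n)%N => [|k IHk].
  by rewrite add0n subrr; exact: cone0.
rewrite addSn /= mulrDr mulr1 addrAC; apply: cone_add => //.
have [cg cp] := newton_cone (k + n).
by apply: cone_mul => //; apply: cone_mul => //; exact: cone_phalf.
Qed.

(** Visser's iteration c := (t + c^2) / 2, whose limit is 1 - sqrt (1 - t) *)
Fixpoint visser k : {poly C} :=
  if k is k'.+1 then phalf * ('X + visser k' ^+ 2) else 0.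

Lemma visser0 : visser 0 = 0. Proof. by []. Qed.

Lemma visserS k : visser k.+1 = phalf * ('X + visser k ^+ 2).
Proof. by []. Qed.

Lemma visser_cone k : cone (visser k) /\ cone (1 - visser k).
Proof.
have c1 := cone1; have ch := cone_phalf; have cX := coneX; have cX' := coneBX.
elim: k => [|k [cg cp]] /=; first by rewrite subr0; split=> //; exact: cone0.
split; first by apply: cone_mul => //; apply: cone_add => //; apply: cone_exp.
set c := visser k in cg cp *.
have -> : 1 - phalf * ('X + c ^+ 2) = phalf * ((1 - 'X) + (1 - c) * (1 + c)).
  transitivity ((1 - (phalf + phalf)) + phalf * ((1 - 'X) + (1 - c) * (1 + c))).
    by ring.
  by rewrite phalfD subrr add0r.
by repeat (apply: cone_mul || apply: cone_add) => //.
Qed.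

Lemma visser_mono n m : (n <= m)%N -> cone (visser m - visser n).
Proof.
move=> nm; rewrite -(subnK nm); elim: (m - n)%N => [|k IHk].
  by rewrite add0n subrr; exact: cone0.
rewrite addSn -(subrKA (visser (k + n))); apply: cone_add => //.
elim: (k + n)%N => [|j IHj].
  rewrite visserS visser0 subr0 expr0n addr0.
  by apply: cone_mul; [exact: cone_phalf|exact: coneX].
have -> : visser j.+2 - visser j.+1 =
    phalf * ((visser j.+1 - visser j) * (visser j.+1 + visser j)).
  rewrite (visserS j.+1) {2}(visserS j); ring.
apply: cone_mul; first exact: cone_phalf.
by apply: cone_mul => //; apply: cone_add; exact: (visser_cone _).1.
Qed.

End Cone.

Section Calculus.
Variables (K : realType) (H : hilbert K) (R : II1_factor H).
Local Notation M := (vnop R).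
Local Notation C := K[i].
Local Notation "''<' x , y >" := (dotp H x y).
Implicit Types (x y z : M) (u w : nat -> M) (c : C).

Definition psd x := forall v, 0 <= '<x v, v>.

Lemma psdD x y : psd x -> psd y -> psd (x + y).
Proof. by move=> px py v; rewrite opD dotpDl addr_ge0. Qed.

Lemma psdZ c x : 0 <= c -> psd x -> psd (c *: x).
Proof. by move=> c0 px v; rewrite opZ dotpZl mulr_ge0. Qed.

Lemma psd_conj x z : psd z -> psd (star x * z * x).
Proof. by move=> pz v; rewrite !opM -starPr; exact: pz. Qed.

Lemma psd_star_mul x : psd (star x * x).
Proof. by move=> v; rewrite dot_starM exprn_ge0. Qed.

Lemma contractive_psd x : contractive x -> psd (1 - star x * x).
Proof.
move=> xc v; rewrite opB op1 dotpDl dotpNl dot_starM -dotpE subr_ge0.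
by rewrite ler_pXn2r ?nnegrE.
Qed.

Lemma psd_contractive x : psd (1 - star x * x) -> contractive x.
Proof.
move=> px v; have := px v; rewrite opB op1 dotpDl dotpNl dot_starM -dotpE subr_ge0.
by rewrite ler_pXn2r ?nnegrE.
Qed.

Section UnitInterval.
Variable a : M.
Hypotheses (a_sa : star a = a) (a_ge0 : psd a) (a_le1 : psd (1 - a)).
Local Notation ev := (horner_alg a).

(** Conjugation by a or by 1 - a raises one exponent by two and preserves
    positivity, so only exponents 0 and 1 remain.  For the last case
    a (1 - a) = a (1 - a) a + (1 - a) a (1 - a). *)
Lemma psd_monomial i j : psd (a ^+ i * (1 - a) ^+ j).
Proof.
have b_sa : star (1 - a) = 1 - a by rewrite starB star1 a_sa.
have ab : a * (1 - a) = (1 - a) * a by rewrite mulrBl mulrBr mul1r mulr1.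
have abX n : a * (1 - a) ^+ n = (1 - a) ^+ n * a.
  by apply: commrX; exact: ab.
have stepa k l : psd (a ^+ k * (1 - a) ^+ l) -> psd (a ^+ k.+2 * (1 - a) ^+ l).
  move=> h; have := psd_conj a h.
  by rewrite a_sa mulrA -exprS -mulrA -abX mulrA -exprSr.
have stepb k l : psd (a ^+ k * (1 - a) ^+ l) -> psd (a ^+ k * (1 - a) ^+ l.+2).
  move=> h; have := psd_conj (1 - a) h.
  have -> : star (1 - a) * (a ^+ k * (1 - a) ^+ l) = a ^+ k * (1 - a) ^+ l.+1.
    by rewrite b_sa mulrA (commrX k (esym ab)) -mulrA -exprS.
  by rewrite -mulrA -exprSr.
have [n] := ubnP (i + j); elim: n i j => // n IHn i j ijn.
case: i ijn => [|[|i]] ijn; last first.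
- by apply: stepa; apply: IHn; rewrite !addSn ltnS in ijn; exact: ltnW.
- case: j ijn => [|[|j]] ijn; last first.
  + by apply: stepb; apply: IHn; rewrite !addnS ltnS in ijn; exact: ltnW.
  + have -> : a ^+ 1 * (1 - a) ^+ 1 = star a * (1 - a) * a + star (1 - a) * a * (1 - a).
      by rewrite !expr1 a_sa b_sa -ab -mulrDr addrCA subrr addr0 mulr1.
    by apply: psdD; apply: psd_conj.
  + by rewrite expr1 mulr1.
- case: j ijn => [|[|j]] ijn; last first.
  + by apply: stepb; apply: IHn; rewrite !addnS ltnS in ijn; exact: ltnW.
  + by rewrite mul1r expr1.
  + by move=> v; rewrite mulr1 op1 -dotpE exprn_ge0.
Qed.

Lemma psd_cone p : cone p -> psd (ev p).
Proof.
elim=> [c i j c0|q r _ pq _ pr]; last by rewrite rmorphD; apply: psdD.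
rewrite linearZ_LR rmorphM !rmorphXn rmorphB rmorph1 /= horner_algX ?mulr_algl.
by apply: psdZ => //; exact: psd_monomial.
Qed.

Lemma star_cone p : cone p -> star (ev p) = ev p.
Proof.
have starX x n : star x = x -> star (x ^+ n) = x ^+ n.
  move=> xs; elim: n => [|n IHn]; first by rewrite expr0 star1.
  by rewrite {1}exprS starM IHn xs exprSr.
elim=> [c i j c0|q r _ pq _ pr]; last by rewrite rmorphD starD pq pr.
rewrite linearZ_LR rmorphM !rmorphXn rmorphB rmorph1 /= horner_algX ?mulr_algl.
have b_sa : star (1 - a) = 1 - a by rewrite starB star1 a_sa.
rewrite starZ starM !starX // geC0_conj //; congr (_ *: _).
apply: commrX; apply: commr_sym; apply: commrX.
by apply: commrB; [exact: commr1|].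
Qed.

End UnitInterval.

Definition strongly_closed (P : M -> Prop) :=
  forall u x, (forall n, P (u n)) -> strong_lim u x -> P x.

Section Monotone.
Variable a : M.
Hypotheses (a_sa : star a = a) (a_ge0 : psd a) (a_le1 : psd (1 - a)).
Local Notation ev := (horner_alg a).

(** A difference d of two terms satisfies 0 <= d <= 1, hence d^2 <= d as
    polynomials of the cone, so that |d v|^2 is dominated by an increment of the
    monotone sequence of the numbers <p n (a) v, v>. *)
Lemma cone_lim (p : nat -> {poly C}) :
  (forall n, cone (p n)) -> (forall n, cone (1 - p n)) ->
  (forall n m, (n <= m)%N -> cone (p m - p n)) ->
  (forall n, contractive (ev (p n))) /\ exists x, strong_lim (fun n => ev (p n)) x.
Proof.
move=> p0 p1 pm.
have evc q : cone q -> cone (1 - q) -> contractive (ev q).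
  move=> cq cq'; apply: psd_contractive; rewrite star_cone //.
  have -> : 1 - ev q * ev q = ev ((1 - q) * (1 + q)).
    by rewrite -rmorphM -(rmorph1 ev) -rmorphB; congr ev; ring.
  by apply: psd_cone => //; apply: cone_mul => //; apply: cone_add => //; exact: cone1.
split=> [n|]; first exact: evc.
apply: strong_lim_exists => [n|v]; first exact: evc.
apply: (@cvgn_of_monotone _ _ _ (fun n => '<ev (p n) v, v>) '<v, v>).
- move=> n m nm; set d := p m - p n; have cd := pm _ _ nm.
  have cd1 : cone (1 - d).
    have -> : 1 - d = (1 - p m) + p n by rewrite /d; ring.
    exact: cone_add.
  have -> : '<ev (p m) v, v> - '<ev (p n) v, v> = '<ev d v, v>.
    by rewrite -dotpNl -dotpDl rmorphB.
  have -> : `|ev (p m) v - ev (p n) v| ^+ 2 = '<ev (d * d) v, v>.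
    by rewrite -opB -rmorphB -dot_starM star_cone // -rmorphM.
  rewrite -subr_ge0 -dotpNl -dotpDl.
  have -> : ev d v - ev (d * d) v = ev (d * (1 - d)) v.
    by rewrite -opB -rmorphB; congr (op_fun (ev _) v); ring.
  by apply: psd_cone => //; exact: cone_mul.
- by move=> n; apply: psd_cone.
- move=> n; rewrite -subr_ge0 -dotpNl -dotpDl.
  have -> : v - ev (p n) v = (ev (1 - p n)) v by rewrite rmorphB rmorph1.
  exact: psd_cone.
Qed.

End Monotone.

End Calculus.

(** * Square roots and polar decompositions *)

Section Polar.
Variables (K : realType) (H : hilbert K) (R : II1_factor H).
Local Notation M := (vnop R).
Local Notation C := K[i].
Local Notation "''<' x , y >" := (dotp H x y).
Implicit Types (x y z : M) (u w : nat -> M) (c : C).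

Lemma ev_half a : horner_alg a (phalf K) = (2^-1 : C) *: 1 :> M.
Proof. exact: horner_algC. Qed.

(** The limit x of Visser's iteration satisfies x = (a + x^2) / 2, that is,
    (1 - x)^2 = 1 - a. *)
Lemma sqrt_exists a : star a = a -> psd a -> psd (1 - a) ->
  exists2 z : M, star z = z & z * z = 1 - a.
Proof.
move=> asa a0 a1.
have [con [x lx]] := cone_lim asa a0 a1 (fun n => (@visser_cone K n).1)
  (fun n => (@visser_cone K n).2) (@visser_mono K).
have sx : star x = x.
  apply: (strong_lim_star _ lx lx) => n; apply: star_cone => //.
  exact: (@visser_cone K n).1.
have rec : x = 2^-1 *: (a + x * x).
  have l1 : strong_lim (fun n => horner_alg a (visser K n.+1)) x.
    by move=> v; have := lx v; rewrite -(cvg_shiftS (fun n => horner_alg a (visser K n) v)).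
  have l2 : strong_lim
     (fun n => 2^-1 *: (a + horner_alg a (visser K n) * horner_alg a (visser K n)))
     (2^-1 *: (a + x * x)).
    apply: strong_limZ; apply: strong_limD; first exact: strong_lim_cst.
    exact: strong_limM.
  apply: strong_lim_unique l1 _.
  have -> // : (fun n => horner_alg a (visser K n.+1)) =
    (fun n => 2^-1 *: (a + horner_alg a (visser K n) * horner_alg a (visser K n))).
  apply/funext => n; rewrite visserS rmorphM rmorphD rmorphXn /= ev_half.
  by rewrite horner_algX expr2 mulr_algl.
exists (1 - x); first by rewrite starB star1 sx.
have {}rec : x + x = a + x * x.
  rewrite {1 2}rec -scalerDl (_ : 2^-1 + 2^-1 = 1 :> C) ?scale1r //.
  by rewrite [RHS](splitr 1) mul1r.
rewrite mulrBl mul1r mulrBr mulr1 opprB.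
have -> : 1 - x + (x * x - x) = 1 - (x + x) + x * x by rewrite opprD !addrA addrAC.
by rewrite rec opprD addrA subrK.
Qed.

(** With 1 - x^* x = z^2 and z self-adjoint, the difference of the two sides is
    the trace of (z y)^* (z y). *)
Lemma tau_contractive x y : contractive x ->
  tau (star (x * y) * (x * y)) <= tau (star y * y).
Proof.
move=> xc; have sa : star (star x * x) = star x * x by rewrite starM starK.
have [z zs zz] := sqrt_exists sa (@psd_star_mul _ _ _ x) (contractive_psd xc).
rewrite -subr_ge0 -tauB starM -mulrA (mulrA (star x)).
have -> : star y * y - star y * (star x * x * y) = star (z * y) * (z * y).
  transitivity (star y * (z * z) * y).
    by rewrite zz mulrBr mulr1 mulrBl !mulrA.
  by rewrite starM zs !mulrA.
exact: tau_ge0.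
Qed.

(** The Newton-Schulz step x (3 - x^* x) / 2, written so that the correction
    vanishes when x is a partial isometry *)
Definition polar_step x := x * (1 + 2^-1 *: (1 - star x * x)).

Section PolarDecomposition.
Variable y : M.
Hypothesis yc : contractive y.
Local Notation a := (star y * y).
Local Notation ev := (horner_alg a).

(** The iterates u n = y g_n (y^* y) converge strongly, because u n^* u n increases
    and |u m t - u n t|^2 is at most |u m t|^2 - |u n t|^2 for n <= m.  The limit v
    is a fixed point, v = v (3 - v^* v) / 2, which makes v^* v idempotent.  The
    second clause keeps v away from 0; the last one transports to v every property
    of y that is preserved by the iteration and by limits. *)
Lemma polar : exists v : M,
  [/\ star v * v * (star v * v) = star v * v,
      forall t, `|y t| ^+ 2 <= '<v t, y t>
    & forall P : M -> Prop, (forall x, P x -> P (polar_step x)) ->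
        strongly_closed P -> P y -> P v].
Proof.
have asa : star a = a by rewrite starM starK.
have a0 : psd a := @psd_star_mul _ _ _ y.
have a1 : psd (1 - a) := contractive_psd yc.
pose g n := newton K n; pose p n := 'X * g n ^+ 2.
have cg n : cone (g n) := (@newton_cone K n).1.
have cX := @coneX K.
have cp n : cone (p n) by apply: cone_mul => //; exact: cone_exp.
have cp1 n : cone (1 - p n) := (@newton_cone K n).2.
have cgm n m : (n <= m)%N -> cone (g m - g n) by exact: newton_mono.
have cpm n m : (n <= m)%N -> cone (p m - p n).
  move=> nm; have -> : p m - p n = 'X * ((g m - g n) * (g m + g n)).
    by rewrite /p; ring.
  by apply: cone_mul => //; apply: cone_mul; [exact: cgm|exact: cone_add].
pose u n := y * ev (g n).
have uu n m : star (u n) * u m = ev ('X * g n * g m).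
  rewrite starM star_cone // mulrA -(mulrA _ (star y) y).
  by rewrite [X in _ * X * _](esym (horner_algX a)) -!rmorphM [_ * 'X]mulrC.
have uuX n m : star (u n) * u m = ev ('X * (g n * g m)) by rewrite uu mulrA.
have uc n : contractive (u n).
  apply: psd_contractive; have -> : 1 - star (u n) * u n = ev (1 - p n).
    by rewrite uuX -expr2 rmorphB rmorph1.
  exact: psd_cone (cp1 n).
have uv s t n m : '<u m s, u n t> = '<ev ('X * (g n * g m)) s, t>.
  by rewrite -uuX opM [RHS]starP starK.
have [v lv] : exists v, strong_lim u v.
  apply: strong_lim_exists => // t.
  apply: (@cvgn_of_monotone _ _ _ (fun n => '<ev (p n) t, t>) '<t, t>).
  - move=> n m nm.
    have -> : '<ev (p m) t, t> - '<ev (p n) t, t> = '<ev (p m - p n) t, t>.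
      by rewrite -dotpNl -dotpDl rmorphB.
    have -> : `|u m t - u n t| ^+ 2 = '<ev ('X * (g m - g n) ^+ 2) t, t>.
      rewrite -opB -dot_starM; congr '<op_fun _ t, t>.
      rewrite starB mulrBl !mulrBr !uuX -!rmorphB; congr ev; ring.
    rewrite -subr_ge0 -dotpNl -dotpDl -opB -rmorphB; apply: psd_cone => //.
    have -> : p m - p n - 'X * (g m - g n) ^+ 2 =
        'X * (g n * ((g m - g n) + (g m - g n))).
      by rewrite /p; ring.
    apply: cone_mul => //; apply: cone_mul => //.
    by apply: cone_add; exact: cgm.
  - by move=> n; exact: psd_cone.
  - move=> n; rewrite -subr_ge0 -dotpNl -dotpDl.
    have -> : t - ev (p n) t = ev (1 - p n) t by rewrite rmorphB rmorph1.
    exact: psd_cone.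
have [econ [e le]] := cone_lim asa a0 a1 cp cp1 cpm.
have ustep n : u n.+1 = u n * (1 + 2^-1 *: (1 - ev (p n))).
  have gS : g n.+1 = g n * (1 + phalf K * (1 - p n)) by [].
  rewrite /u gS rmorphM /= mulrA; congr (_ * _).
  by rewrite rmorphD rmorphM rmorphB !rmorph1 /= ev_half mulr_algl.
have vve : star v * v = e.
  apply: op_eq => t; rewrite opM; apply: dotp_injr => s.
  rewrite -starP.
  have l1 : (fun n => '<u n s, u n t>) @ \oo --> ('<v s, v t> : C^o).
    (* the summand 1 only makes the bound positive *)
    apply: (@dot_cvg _ _ _ _ _ _ _ _ _ (`|t| + 1)); [|  |exact: lv|exact: lv].
      by rewrite ltr_wpDl.
    by move=> n; rewrite (le_trans (uc n t)) // lerDl.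
  have l2 : (fun n => '<u n s, u n t>) @ \oo --> ('<s, e t> : C^o).
    have -> : (fun n => '<u n s, u n t>) = (fun n => '<s, ev (p n) t>).
      by apply/funext => n; rewrite uv starPr star_cone // -expr2.
    exact: dot_cvgr (le t).
  exact: cvgC_unique l1 l2.
(* v is a fixed point of the iteration *)
have ve : v = v * e.
  have l1 : strong_lim (fun n => u n.+1) v.
    by move=> t; have := lv t; rewrite -(cvg_shiftS (fun n => u n t)).
  have l2 : strong_lim (fun n => u n.+1) (v * (1 + 2^-1 *: (1 - e))).
    have -> : (fun n => u n.+1) = (fun n => u n * (1 + 2^-1 *: (1 - ev (p n)))).
      by apply/funext.
    apply: strong_limM => //; apply: strong_limD; first exact: strong_lim_cst.
    apply: strong_limZ; apply: strong_limD; first exact: strong_lim_cst.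
    exact: strong_limN.
  have := strong_lim_unique l1 l2; rewrite mulrDr mulr1 -scalerAr => h.
  have {h} : v * (1 - e) = 0.
    have h0 : 2^-1 *: (v * (1 - e)) = 0 by apply: (addrI v); rewrite -h addr0.
    rewrite -[LHS]scale1r -[1](@divff _ (2 : C)) ?pnatr_eq0 // -scalerA h0.
    by rewrite scaler0.
  by rewrite mulrBr mulr1 => /eqP; rewrite subr_eq0 => /eqP.
exists v; split.
- by rewrite vve -{1}vve -mulrA -ve vve.
- move=> t; rewrite -subr_ge0.
  have l : (fun n => '<u n t, y t> - `|y t| ^+ 2) @ \oo --> ('<v t, y t> - `|y t| ^+ 2 : C^o).
    by apply: (@cvgB _ C^o); [exact: dot_cvgl (lv t)|exact: cvg_cst].
  apply: (cvg_ge0 l) => n.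
  have -> : y = u 0 by rewrite /u /g /= rmorph1 mulr1.
  rewrite uv -dot_starM uuX -dotpNl -dotpDl -opB -rmorphB; apply: psd_cone => //.
  have -> : 'X * (g 0 * g n) - 'X * (g 0 * g 0) = 'X * (g n - g 0) by rewrite /g /=; ring.
  by apply: cone_mul => //; exact: cgm.
- move=> P Pstep Pcl Py; apply: (Pcl u) lv => n; elim: n => [|n IHn].
    by rewrite /u /g /= rmorph1 mulr1.
  by rewrite ustep; have := Pstep _ IHn; rewrite /polar_step uuX -expr2.
Qed.

End PolarDecomposition.

End Polar.

(** * Projections and matrix units *)

Section MatrixUnits.
Variables (K : realType) (H : hilbert K) (R : II1_factor H).
Local Notation M := (vnop R).
Local Notation C := K[i].
Local Notation "''<' x , y >" := (dotp H x y).
Implicit Types (x y z e p q : M) (u w : nat -> M) (c : C).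

Definition is_proj e := star e = e /\ e * e = e.

Lemma proj1 : is_proj 1. Proof. by split; rewrite ?star1 ?mul1r. Qed.

Lemma projB e f : is_proj e -> is_proj f -> e * f = f -> is_proj (e - f).
Proof.
move=> [se ee] [sf ff] ef; have fe : f * e = f by rewrite -se -sf -starM ef.
split; first by rewrite starB se sf.
by rewrite mulrBl !mulrBr ee ff ef fe subrr subr0.
Qed.

Lemma projC e : is_proj e -> is_proj (1 - e).
Proof. by move=> pe; apply: projB => //; [exact: proj1|rewrite mul1r]. Qed.

Lemma tau_proj_ge0 e : is_proj e -> 0 <= tau e.
Proof. by move=> [se ee]; rewrite -ee -{1}se; exact: tau_ge0. Qed.

Lemma tau_proj_eq0 e : is_proj e -> tau e = 0 -> e = 0.
Proof. by move=> [se ee] te; apply: tau_faithful; rewrite se ee. Qed.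

Lemma psd_proj e : is_proj e -> psd e.
Proof. by move=> [se ee]; rewrite -ee -{1}se; exact: psd_star_mul. Qed.

Definition rtau x : K := complex.Re (tau x).

Lemma rtauD x y : rtau (x + y) = rtau x + rtau y.
Proof. by rewrite /rtau tauD; case: (tau x); case: (tau y). Qed.

Lemma tau_projE e : is_proj e -> tau e = (rtau e)%:C%C.
Proof.
move=> /tau_proj_ge0; rewrite /rtau; case: (tau e) => a b.
by rewrite lecE /= => /andP[/eqP->].
Qed.

Lemma rtau_proj_ge0 e : is_proj e -> 0 <= rtau e.
Proof. by move=> pe; rewrite -lecR -tau_projE //; exact: tau_proj_ge0. Qed.

Lemma rtau_proj_le1 e : is_proj e -> rtau e <= 1.
Proof.
move=> pe; rewrite -lecR -tau_projE // rmorph1 -(tau1 R) -subr_ge0 -tauB.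
exact/tau_proj_ge0/projC.
Qed.

Section FiniteIndex.
Variable I : finType.
Implicit Types E F : I -> I -> M.

Definition mxunits E :=
  (forall i j, star (E i j) = E j i) /\
  (forall i j k l, E i j * E k l = if j == k then E i l else 0).

Definition supp E : M := \sum_i E i i.

Lemma mxunits0 : mxunits (fun _ _ => 0).
Proof. by split=> *; rewrite ?star0 ?mul0r ?if_same. Qed.

Section MxUnitsTheory.
Variable E : I -> I -> M.
Hypothesis uE : mxunits E.

Lemma supp_mull i j : supp E * E i j = E i j.
Proof.
rewrite /supp mulr_suml (bigD1 i) //= uE.2 eqxx big1 ?addr0 // => k ki.
by rewrite uE.2 (negPf ki).
Qed.

Lemma supp_mulr i j : E i j * supp E = E i j.
Proof.
rewrite /supp mulr_sumr (bigD1 j) //= uE.2 eqxx big1 ?addr0 // => k kj.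
by rewrite uE.2 eq_sym (negPf kj).
Qed.

Lemma supp_proj : is_proj (supp E).
Proof.
split; first by rewrite star_sum; apply: eq_bigr => i _; exact: uE.1.
rewrite {1}/supp mulr_suml; apply: eq_bigr => i _; exact: supp_mulr.
Qed.

Lemma mxunits_proj i : is_proj (E i i).
Proof. by split; rewrite ?uE.1 // uE.2 eqxx. Qed.

Lemma mxunits_contractive i j : contractive (E i j).
Proof.
apply: psd_contractive; rewrite uE.1 uE.2 eqxx.
by apply: psd_proj; apply: projC; exact: mxunits_proj.
Qed.

End MxUnitsTheory.

Lemma suppD E F : supp (fun i j => E i j + F i j) = supp E + supp F.
Proof. exact: big_split. Qed.

Lemma proj_orthC p q : is_proj p -> is_proj q -> p * q = 0 -> q * p = 0.
Proof. by move=> [sp _] [sq _] pq; rewrite -sp -sq -starM pq star0. Qed.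

Lemma mxunits_orth E F : mxunits E -> mxunits F -> supp E * supp F = 0 ->
  forall i j k l, E i j * F k l = 0.
Proof.
move=> uE uF EF i j k l.
rewrite -(supp_mulr uE) -(supp_mull uF) mulrA -(mulrA (E i j)) EF.
by rewrite mulr0 mul0r.
Qed.

Lemma mxunitsD E F : mxunits E -> mxunits F -> supp E * supp F = 0 ->
  mxunits (fun i j => E i j + F i j).
Proof.
move=> uE uF EF.
have FE := proj_orthC (supp_proj uE) (supp_proj uF) EF.
split=> [i j|i j k l]; first by rewrite starD uE.1 uF.1.
rewrite mulrDl !mulrDr (mxunits_orth uE uF) // (mxunits_orth uF uE) //.
by rewrite addr0 add0r uE.2 uF.2; case: eqP => // _; rewrite addr0.
Qed.

(** F extends E by an orthogonal system: E is the part of F under supp E. *)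
Definition mxle E F := forall i j, F i j * supp E = E i j.

Lemma mxle_supp E F : mxle E F -> supp F * supp E = supp E.
Proof. by move=> EF; rewrite {1}/supp mulr_suml; apply: eq_bigr. Qed.

Lemma mxle_mull E F : mxunits E -> mxunits F -> mxle E F ->
  forall i j, supp E * F i j = E i j.
Proof.
move=> uE uF EF i j; have [sE _] := supp_proj uE.
by rewrite -uF.1 -sE -starM EF uE.1.
Qed.

Lemma mxle_diff E F : mxunits E -> mxunits F -> mxle E F -> forall i j,
  star (F i j - E i j) * (F i j - E i j) = F j j - E j j.
Proof.
move=> uE uF EF i j; rewrite starB uF.1 uE.1 mulrBl !mulrBr.
have h1 : F j i * E i j = E j j by rewrite -(EF i j) mulrA uF.2 eqxx EF.
have h2 : E j i * F i j = E j j.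
  by rewrite -(mxle_mull uE uF EF) -mulrA uF.2 eqxx mxle_mull.
by rewrite h1 h2 uE.2 uF.2 eqxx subrr subr0.
Qed.

Section Exhaustion.
Variable J : M -> Prop.
Hypotheses (J0 : J 0) (JD : forall x y, J x -> J y -> J (x + y)).
Hypothesis (Jcl : strongly_closed J).

Definition units_in E := mxunits E /\ forall i j, J (E i j).

(** If the supremum of the available traces is 0 nothing can be gained;
    otherwise some system has more than half of it. *)
Lemma exhaust_step E : exists F, units_in E ->
  [/\ units_in F, supp E * supp F = 0 &
    forall F', units_in F' -> supp E * supp F' = 0 ->
      rtau (supp F') <= rtau (supp F) + rtau (supp F)].
Proof.
have [uE|nE] := pselect (units_in E); last by exists E.
pose S := [set rtau (supp F) | F in [set F | units_in F /\ supp E * supp F = 0]].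
have s0 : supp (fun _ _ => 0) = 0 by apply: big1.
have S0 : S 0.
  exists (fun _ _ => 0); last by rewrite s0 /rtau (tau0 R : tau 0 = 0).
  by rewrite /= s0 mulr0; split=> //; split=> //; exact: mxunits0.
have hS : has_sup S.
  split; first by exists 0.
  by exists 1 => _ [F [[uF _] _] <-]; apply: rtau_proj_le1; exact: supp_proj.
have supS F : units_in F -> supp E * supp F = 0 -> rtau (supp F) <= sup S.
  by move=> uF EF; apply: ub_le_sup; [case: hS|exists F].
have [sS|sS] := leP (sup S) 0.
  have [F [uF EF] F0] := S0; exists F => _; split => // F' uF' EF'.
  by rewrite F0 addr0; apply: le_trans sS; exact: supS.
have s20 : 0 < sup S / 2 by rewrite divr_gt0.
have [_ [F [uF EF] <-] hF] := sup_adherent s20 hS.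
exists F => _; split => // F' uF' EF'; apply: le_trans (supS _ uF' EF') _.
by rewrite [leLHS]splitr; apply: ltW; apply: ltrD;
  rewrite (le_lt_trans _ hF) // {2}[sup S]splitr addrK.
Qed.

(** The greedy systems are orthogonal and their supports have summable traces.  A
    system orthogonal to all of them was available at each step, so its trace is at
    most twice that of each greedy system and must vanish. *)
Lemma exhaustion : exists E, units_in E /\ forall F, units_in F ->
  supp E * supp F = 0 -> supp F = 0.
Proof.
have [step stepP] := boolp.choice exhaust_step.
pose fix E n : I -> I -> M :=
  if n is m.+1 then fun i j => E m i j + step (E m) i j else fun _ _ => 0.
have uE n : units_in (E n).
  elim: n => [|n IHn] /=; first by split=> //; exact: mxunits0.
  have [[uF JF] EF _] := stepP _ IHn.
  split=> [|i j]; first exact: mxunitsD IHn.1 uF EF.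
  by apply: JD; [exact: IHn.2|].
have Ele n m : (n <= m)%N -> mxle (E n) (E m).
  move=> nm; rewrite -(subnK nm); elim: (m - n)%N => [|k IHk] i j.
    by rewrite add0n supp_mulr //; exact: (uE n).1.
  have [[uF JF] EF _] := stepP _ (uE (k + n)).
  have FE0 : step (E (k + n)%N) i j * supp (E (k + n)%N) = 0.
    rewrite -(supp_mulr uF) -mulrA.
    by rewrite (proj_orthC (supp_proj (uE _).1) (supp_proj uF) EF) mulr0.
  by rewrite addSn /= mulrDl IHk -(mxle_supp IHk) mulrA FE0 mul0r addr0.
have limE : forall ij : I * I, exists x, strong_lim (fun n => E n ij.1 ij.2) x.
  move=> [i j] /=; apply: strong_lim_exists => [n|v].
    exact: mxunits_contractive (uE n).1 i j.
  apply: (@cvgn_of_monotone _ _ _ (fun n => '<E n j j v, v>) '<v, v>).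
  - move=> n m nm; rewrite -opB -dot_starM (mxle_diff (uE n).1 (uE m).1 (Ele _ _ nm)).
    by rewrite opB dotpDl dotpNl.
  - by move=> n; apply: psd_proj; exact: mxunits_proj (uE n).1 j.
  - move=> n; rewrite -subr_ge0 -dotpNl -dotpDl.
    by apply: (psd_proj (projC (mxunits_proj (uE n).1 j))).
have [L0 L0P] := boolp.choice limE; pose L i j := L0 (i, j).
have LP i j : strong_lim (fun n => E n i j) (L i j) := L0P (i, j).
have uL : mxunits L.
  split=> [i j|i j k l].
    by apply: (strong_lim_star _ (LP i j) (LP j i)) => n; exact: (uE n).1.1.
  apply: strong_lim_unique.
    apply: (strong_limM (u := fun n => E n i j) (w := fun n => E n k l)) => // n.
    exact: mxunits_contractive (uE n).1 i j.
  have -> : (fun n => E n i j * E n k l) = (fun n => if j == k then E n i l else 0).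
    by apply/funext => n; exact: (uE n).1.2.
  by case: eqP => // _; exact: strong_lim_cst.
have EL n : mxle (E n) L.
  move=> i j; apply: (strong_lim_unique (u := fun=> E n i j)); last exact: strong_lim_cst.
  have h : strong_lim (fun m => E (m + n)%N i j) (L i j).
    by move=> v; have := LP i j v; rewrite -(cvg_shiftn n (fun m => E m i j v)).
  have -> : (fun=> E n i j) = (fun m => E (m + n)%N i j * supp (E n)).
    by apply/funext => m; rewrite Ele // leq_addl.
  exact: strong_limMr.
exists L; split; first by split=> // i j; apply: (Jcl _ (LP i j)) => n; exact: (uE n).2.
move=> F uF LF; have pF := supp_proj uF.1.
have EnF n : supp (E n) * supp F = 0.
  have [sE _] := supp_proj (uE n).1; have [sL _] := supp_proj uL.
  by rewrite -sE -(mxle_supp (EL n)) starM sE sL -mulrA LF mulr0.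
(* each of the first n greedy steps has gained at least half the trace of F *)
have tF n : rtau (supp F) *+ n <= rtau (supp (E n)) + rtau (supp (E n)).
  elim: n => [|n IHn].
    by rewrite mulr0n addr_ge0 //; apply: rtau_proj_ge0; exact: supp_proj (uE 0).1.
  have [_ _ h] := stepP _ (uE n).
  by rewrite mulrS /= suppD rtauD addrACA [_ + rtau _ *+ _]addrC lerD //; exact: h.
have tF0 : rtau (supp F) = 0.
  apply/eqP; rewrite eq_le rtau_proj_ge0 // andbT leNgt; apply/negP => F0.
  have := tF (Num.bound (2 / rtau (supp F))); apply/negP; rewrite -ltNge.
  apply: (@le_lt_trans _ _ 2).
    by rewrite -[2]/(1 + 1); apply: lerD; apply: rtau_proj_le1; exact: supp_proj (uE _).1.
  rewrite -[ltRHS]mulr_natl -ltr_pdivrMr //; apply: archi_boundP.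
  by rewrite divr_ge0 // ltW.
by apply: tau_proj_eq0 => //; rewrite tau_projE // tF0.
Qed.

End Exhaustion.
End FiniteIndex.
End MatrixUnits.

(** * Comparison of projections in a factor *)

Section Factor.
Variables (K : realType) (H : hilbert K) (R : II1_factor H).
Local Notation M := (vnop R).
Local Notation C := K[i].
Local Notation "''<' x , y >" := (dotp H x y).
Implicit Types (x y z b e f p q v : M) (u w : nat -> M) (c : C).

Lemma scale_contractive x : exists2 c, 0 < c & contractive (c *: x).
Proof.
have [c c0 hc] := op_bounded x; exists c^-1; first by rewrite invr_gt0.
by move=> t; rewrite opZ normrZ gtr0_norm ?invr_gt0 // ler_pdivrMl.
Qed.

(** With e = v^* v idempotent, (v e - v)^* (v e - v) = (e - 1) e (e - 1) = 0. *)
Lemma partial_isometryP v : star v * v * (star v * v) = star v * v ->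
  v * (star v * v) = v.
Proof.
move=> ee; apply/eqP; rewrite -subr_eq0; apply/eqP; apply: star_mul_eq0.
have -> : v * (star v * v) - v = v * (star v * v - 1) by rewrite mulrBr mulr1.
rewrite starM -mulrA (mulrA (star v)) starB starM starK star1.
by rewrite mulrBr mulr1 ee subrr mulr0.
Qed.

Lemma strongly_closed_fixl z : strongly_closed (fun x => z * x = x).
Proof.
move=> u x /= zu ux; have h := strong_limMl (z := z) ux; apply: strong_lim_unique h _.
by have -> : (fun n => z * u n) = u by apply/funext.
Qed.

Lemma strongly_closed_fixr z : strongly_closed (fun x => x * z = x).
Proof.
move=> u x /= zu ux; have h := strong_limMr (z := z) ux; apply: strong_lim_unique h _.
by have -> : (fun n => u n * z) = u by apply/funext.
Qed.

Lemma strongly_closed_annl z : strongly_closed (fun x => z * x = 0).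
Proof.
move=> u x /= zu ux; have h := strong_limMl (z := z) ux; apply: strong_lim_unique h _.
have -> : (fun n => z * u n) = (fun=> 0) by apply/funext.
exact: strong_lim_cst.
Qed.

Lemma strongly_closed_sa : strongly_closed (fun x => star x = x).
Proof. by move=> u x /= su ux; apply: (strong_lim_star _ ux ux). Qed.

Lemma strongly_closed_ker t : strongly_closed (fun x : M => x t = 0).
Proof.
move=> u x /= ut ux; apply/esym.
apply: (@cvg_unique _ (@norm_hausdorff _ H) _ _ _ _ _ (ux t)).
by rewrite (_ : (fun n => u n t) = fun=> 0); [exact: cvg_cst|apply/funext].
Qed.

Lemma polar_step_sa x : star x = x -> star (polar_step x) = polar_step x.
Proof.
move=> sx; rewrite /polar_step !sx starM sx starD starZ starB starM sx star1.
rewrite geC0_conj ?invr_ge0 ?ler0n //.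
rewrite mulrDl mul1r mulrDr mulr1 -scalerAl -scalerAr.
by rewrite mulrBl mulrBr mul1r mulr1 mulrA.
Qed.

Lemma polar_step_ker x t : x t = 0 -> polar_step x t = 0.
Proof.
move=> xt; rewrite opM opD op1 opZ opB op1 opM xt op_vec0 subr0.
by rewrite op_vecD op_vecZ xt scaler0 addr0.
Qed.

Lemma polar_step_fixr x p : x * p = x -> polar_step x * p = polar_step x.
Proof.
move=> xp; rewrite /polar_step -mulrA mulrDl mul1r mulrDr xp [RHS]mulrDr mulr1.
by congr (_ + _); rewrite -scalerAl mulrBl mul1r -mulrA xp -!scalerAr !mulrBr xp mulr1.
Qed.

(** The properties that y shares with its polar part.  Stability under scalars
    lets the polar part be taken after rescaling y to a contraction. *)
Definition polar_stable (P : M -> Prop) :=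
  [/\ forall x, P x -> P (polar_step x), strongly_closed P
    & forall c x, P x -> P (c *: x)].

Lemma polar_stable_ideal (P : M -> Prop) :
  strongly_closed P -> (forall x z, P x -> P (x * z)) -> polar_stable P.
Proof.
move=> Pcl PM; split=> // [x Px|c x Px]; first exact: PM.
by rewrite -[x]mulr1 scalerAr; apply: PM.
Qed.

Lemma polar_stable_fixl q : polar_stable (fun x => q * x = x).
Proof.
apply: polar_stable_ideal => [|x z qx]; first exact: strongly_closed_fixl.
by rewrite mulrA qx.
Qed.

Lemma polar_stable_annl q : polar_stable (fun x => q * x = 0).
Proof.
apply: polar_stable_ideal => [|x z qx]; first exact: strongly_closed_annl.
by rewrite mulrA qx mul0r.
Qed.

Lemma polar_stable_fixr p : polar_stable (fun x => x * p = x).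
Proof.
split=> [x|y|c x xp]; [exact: polar_step_fixr|exact: strongly_closed_fixr|].
by rewrite -scalerAl xp.
Qed.

Lemma polar_nz y : y != 0 -> exists v,
  [/\ v != 0, is_proj (star v * v), v * (star v * v) = v
    & forall P, polar_stable P -> P y -> P v].
Proof.
move=> y0; have [c c0 cy] := scale_contractive y.
have [v [vi vy vP]] := polar cy; exists v; split.
- apply: contraNneq y0 => v0; apply/eqP; apply: op_eq => t.
  have := vy t; rewrite v0 op0 dotp0l.
  rewrite real_exprn_even_le0 ?normr_real // normr_eq0 opZ scaler_eq0.
  by rewrite (gt_eqF c0) /= => /eqP.
- by split; rewrite // starM starK.
- exact: partial_isometryP.
- by move=> P [P1 P2 P3] Py; apply: vP => //; apply: P3.
Qed.

Lemma central_scalar x : (forall y, x * y = y * x) -> exists c, x = c *: 1.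
Proof.
move=> xc; have [|c xE] := II1_factorial (op_mem x).
  move=> T AT; have /(congr1 (@op_fun _ _ _)) := xc (VnOp AT).
  by [].
by exists c; apply: op_eq => v; rewrite xE.
Qed.

(** If q M p = 0, the strongly closed two-sided ideal of all y with q M y = 0
    contains p.  A projection e that exhausts it is a unit for the ideal: the range
    projection of y - e y would be a projection of the ideal orthogonal to e.
    Hence e is central, so it is 1, and q = 0. *)
Lemma factor_link p q : p != 0 -> q != 0 -> exists x, q * x * p != 0.
Proof.
move=> p0 q0; apply: contrapT => /forallNP qp.
pose J y := forall x, q * x * y = 0.
have Jp : J p by move=> x; apply/eqP/negPn/negP; exact: qp.
have Jcl : strongly_closed J.
  by move=> u y Ju uy x; apply: (strongly_closed_annl _ uy) => n; exact: Ju.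
have JMr y z : J y -> J (y * z) by move=> Jy x; rewrite mulrA Jy mul0r.
have JMl y z : J y -> J (z * y) by move=> Jy x; rewrite mulrA -(mulrA q) Jy.
have J0 : J 0 by move=> x; rewrite mulr0.
have JD x y : J x -> J y -> J (x + y).
  by move=> Jx Jy z; rewrite mulrDr Jx Jy addr0.
have [E [[uE JE] Emax]] := @exhaustion _ _ R unit J J0 JD Jcl.
pose e := E tt tt.
have suppE (F : unit -> unit -> M) : supp F = F tt tt.
  by rewrite /supp (bigD1 tt) //= big1 ?addr0 // => -[].
have [se ee] : is_proj e by exact: mxunits_proj.
have Je : J e := JE tt tt.
have eJ y : J y -> e * y = y.
  move=> Jy; apply/eqP; rewrite eq_sym -subr_eq0; apply/negPn/negP => w0.
  have [v [v0 pv vi vP]] := polar_nz w0.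
  have Jv : J v.
    apply: (vP J); first exact: polar_stable_ideal.
    by rewrite -mulN1r; apply: JD => //; apply: (JMl); exact: (JMl).
  have ev : e * v = 0.
    apply: (vP (fun x => e * x = 0)); first exact: polar_stable_annl.
    by rewrite mulrBr mulrA ee subrr.
  have pf : is_proj (v * star v).
    split; first by rewrite starM starK.
    by rewrite mulrA -(mulrA v) vi.
  have := Emax (fun _ _ => v * star v); rewrite !suppE mulrA ev mul0r => h.
  have {}h : v * star v = 0.
    apply: h => //; split=> [|_ _]; last exact: JMr.
    by split=> [[] []|[] [] [] []]; [exact: pf.1|exact: pf.2].
  have : star v = 0 by apply: star_mul_eq0; rewrite starK.
  by move/(congr1 (@star _ _ R)); rewrite starK star0 => /eqP; rewrite (negPf v0).
(* M e is contained in the ideal, of which e is a left unit; take adjoints *)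
have ec x : e * x = x * e.
  have h z : z * e = e * (z * e) by rewrite eJ //; exact: JMl.
  have := congr1 (@star _ _ R) (h (star x)); rewrite !starM starK se.
  by rewrite -mulrA -h.
have [c eE] := central_scalar ec.
have pE : p = c *: p by rewrite -{1}(eJ p Jp) eE -scalerAl mul1r.
have c1 : c = 1.
  apply/eqP; rewrite -subr_eq0; move/eqP: pE; rewrite -{1}[p]scale1r -subr_eq0.
  by rewrite -scalerBl scaler_eq0 (negPf p0) orbF -opprB oppr_eq0.
have := Je 1; rewrite eE c1 scale1r !mulr1 => q00.
by rewrite q00 eqxx in q0.
Qed.

End Factor.

(** * Absence of minimal projections *)

Section Minimal.
Variables (K : realType) (H : hilbert K) (R : II1_factor H).
Local Notation M := (vnop R).
Local Notation C := K[i].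
Local Notation "''<' x , y >" := (dotp H x y).
Implicit Types (x y z b e f p q v : M) (u w : nat -> M) (c : C).

Definition minimal_proj p :=
  [/\ is_proj p, p != 0 & forall f, is_proj f -> p * f = f -> f = 0 \/ f = p].

(** Let y be b - l p, where l is chosen so that <y xi, xi> = 0 for some vector xi of
    the range of p.  Its polar part v is a self-adjoint partial isometry, the sign
    of y.  By minimality the spectral projection (p + v) / 2 is 0 or p, so that
    v = p or v = -p unless y = 0.  Then |y xi|^2 <= <v xi, y xi> = 0, so y and
    therefore v vanish at xi, which is absurd. *)
Lemma minimal_scalar_sa p b : minimal_proj p -> star b = b -> p * b * p = b ->
  exists c, b = c *: p.
Proof.
move=> [[sp pp] p0 pmin] sb pbp.
have [xi pxi xi0] : exists2 xi : H, p xi = xi & xi != 0.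
  apply: contrapT => nxi; move/eqP: p0; apply; apply: op_eq => t.
  apply/eqP/negPn/negP => pt; apply: nxi; exists (p t) => //.
  by rewrite -opM pp.
have pb : p * b = b by rewrite -pbp !mulrA pp.
have bp : b * p = b by rewrite -pbp -!mulrA pp.
pose l := '<b xi, xi> / '<xi, xi>.
have xx : '<xi, xi> != 0 by rewrite -dotpE sqrf_eq0 normr_eq0.
have lr : conjC l = l.
  rewrite /l rmorphM fmorphV /= -!dotpC; congr (_ / _).
  by rewrite starPr sb.
pose y0 := b - l *: p.
have sy0 : star y0 = y0 by rewrite starB starZ sb sp lr.
have y0xi : '<y0 xi, xi> = 0.
  by rewrite opB opZ pxi dotpDl dotpNl dotpZl divfK // subrr.
have [c c0 cy] := scale_contractive y0; set y := c *: y0 in cy.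
have sy : star y = y by rewrite starZ sy0 geC0_conj // ltW.
have py : p * y = y by rewrite -scalerAr mulrBr pb -scalerAr pp.
have yp : y * p = y by rewrite -scalerAl mulrBl bp -scalerAl pp.
have yxi : '<y xi, xi> = 0 by rewrite opZ dotpZl y0xi mulr0.
have [v [vi vy vP]] := polar cy.
have sv : star v = v.
  exact: (vP (fun x => star x = x) (@polar_step_sa _ _ R)
    (@strongly_closed_sa _ _ R) sy : star v = v).
have pv : p * v = v.
  have [h1 h2 _] := polar_stable_fixl p.
  exact: (vP (fun x => p * x = x) h1 h2 py : p * v = v).
have vp : v * p = v.
  have [h1 h2 _] := polar_stable_fixr p.
  exact: (vP (fun x => x * p = x) h1 h2 yp : v * p = v).
suff y00 : y = 0.
  exists l; apply/eqP; rewrite -subr_eq0 -/y0.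
  by move/eqP: y00; rewrite scaler_eq0 gt_eqF.
have v00 : v = 0 -> y = 0.
  move=> v0; apply: op_eq => t; apply/eqP.
  have := vy t; rewrite v0 op0 dotp0l.
  by rewrite real_exprn_even_le0 ?normr_real // normr_eq0.
rewrite sv in vi.
have pe : is_proj (v * v) by split=> //; rewrite starM sv.
have [e0|eE] := pmin _ pe (etrans (mulrA _ _ _) (congr1 (fun x => x * v) pv)).
  by apply: v00; apply: star_mul_eq0; rewrite sv.
have vxi : v xi = xi \/ v xi = - xi.
  pose f := 2^-1 *: (p + v) : M.
  have h2 : (2^-1 : C) * 2 = 1 by rewrite mulVf // pnatr_eq0.
  have ff : f * f = f.
    have pv2 : p + v + (v + p) = (2 : C) *: (p + v).
      by rewrite [v + p]addrC scaler_nat mulr2n.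
    rewrite /f -scalerAl -scalerAr mulrDl !mulrDr pp pv vp eE pv2.
    by rewrite [2^-1 *: (2 *: _)]scalerA h2 scale1r.
  have sf : star f = f.
    by rewrite starZ starD sp sv geC0_conj // invr_ge0 ler0n.
  have pf : p * f = f by rewrite -scalerAr mulrDr pp pv.
  have vE : v = f + f - p.
    have h1 : 2^-1 + 2^-1 = 1 :> C by rewrite [RHS](splitr 1) mul1r.
    by rewrite /f -scalerDl h1 scale1r [p + v]addrC addrK.
  have [f0|fp] := pmin f (conj sf ff) pf.
    by right; rewrite vE f0 add0r sub0r opN pxi.
  by left; rewrite vE fp addrK pxi.
have yxi0 : y xi = 0.
  have xiy : '<xi, y xi> = 0 by rewrite dotpC yxi conjC0.
  have yle : `|y xi| ^+ 2 <= 0.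
    by have := vy xi; have [->|->] := vxi; rewrite ?dotpNl xiy ?oppr0.
  apply/eqP; move: yle.
  by rewrite real_exprn_even_le0 ?normr_real // normr_eq0.
have vxi0 : v xi = 0.
  exact: (vP (fun x => x xi = 0) (fun x => @polar_step_ker _ _ _ x xi)
    (@strongly_closed_ker _ _ _ xi) yxi0 : v xi = 0).
case: vxi => e; move/eqP: xi0; case; first by rewrite -e.
by rewrite -[xi]opprK -e vxi0 oppr0.
Qed.

End Minimal.

Section TypeII.
Variables (K : realType) (H : hilbert K) (R : II1_factor H).
Local Notation M := (vnop R).
Local Notation C := K[i].
Local Notation "''<' x , y >" := (dotp H x y).
Implicit Types (x y z b e f p q : M) (c : C).

(** Real and imaginary parts *)
Lemma minimal_scalar p b : minimal_proj p -> p * b * p = b ->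
  exists c, b = c *: p.
Proof.
move=> pmin pbp; have [[sp _] _ _] := pmin.
have pbs : p * star b * p = star b by rewrite -{2}pbp !starM sp mulrA.
have [||c1 h1] := @minimal_scalar_sa _ _ R p (b + star b) pmin.
- by rewrite starD starK addrC.
- by rewrite mulrDr mulrDl pbp pbs.
have [||c2 h2] := @minimal_scalar_sa _ _ R p ('i *: (b - star b)) pmin.
- by rewrite starZ starB starK conjCi scaleNr -scalerN opprB.
- by rewrite -scalerAr -scalerAl mulrBr mulrBl pbp pbs.
exists (2^-1 * (c1 - 'i * c2)); rewrite -scalerA scalerBl -scalerA -h1 -h2.
rewrite scalerA -expr2 sqrCi scaleN1r opprK addrCA -addrA subrr addr0.
have h : 2^-1 + 2^-1 = 1 :> C by rewrite [RHS](splitr 1) mul1r.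
by rewrite scalerDr -scalerDl h scale1r.
Qed.

Lemma op_fun_sum (I : Type) (r : seq I) (P : pred I) (F : I -> M) :
  op_fun (\sum_(i <- r | P i) F i) = \sum_(i <- r | P i) op_fun (F i).
Proof. exact: (big_morph (@op_fun _ _ R)). Qed.

(** Partial isometries with the common initial projection p and orthogonal final
    projections *)
Definition isometries (I : finType) p (v : I -> M) :=
  forall i j, star (v i) * v j = if i == j then p else 0.

Lemma isometries_mxunits (I : finType) p (v : I -> M) : is_proj p ->
  isometries p v -> mxunits (fun i j => v i * star (v j)).
Proof.
move=> [sp pp] vp.
have vip i : v i * p = v i.
  have h : star (v i) * v i = p by rewrite vp eqxx.
  by rewrite -h; apply: partial_isometryP; rewrite h.
split=> [i j|i j k l]; first by rewrite starM starK.
rewrite mulrA -(mulrA (v i)) vp; case: eqP => // _; last by rewrite mulr0 mul0r.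
by rewrite vip.
Qed.

Lemma isometries_fixr (I : finType) p (v : I -> M) : is_proj p ->
  isometries p v -> forall i, v i * p = v i.
Proof.
move=> [sp pp] vp i; have h : star (v i) * v i = p by rewrite vp eqxx.
by rewrite -h; apply: partial_isometryP; rewrite h.
Qed.

Lemma isometries_supp (I : finType) p (v : I -> M) : is_proj p ->
  isometries p v -> forall i, supp (fun i j => v i * star (v j)) * v i = v i.
Proof.
move=> pp vp i; have h : star (v i) * v i = p by rewrite vp eqxx.
rewrite -(isometries_fixr pp vp i) -h !(mulrA (v i)) mulrA.
by rewrite (supp_mull (isometries_mxunits pp vp)).
Qed.

(** Families of partial isometries with initial projection p have at most 1 / tau p
    members.  In a family of maximal size the final projections add up to 1, since
    the remainder would be linked to p; the polar part of the link is a new member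
    because p is minimal.  Then M is spanned by the matrix units, the corner p M p
    being scalar. *)
Lemma minimal_finite_dim p : minimal_proj p -> finite_dim (carrier R).
Proof.
move=> pmin; have [[sp pp] p0 pm] := pmin.
have pp' : is_proj p by [].
have tp0 : 0 < rtau p.
  rewrite lt_neqAle rtau_proj_ge0 // andbT eq_sym.
  by apply: contra p0 => /eqP t0; apply/eqP/tau_proj_eq0; rewrite ?tau_projE ?t0.
pose Q m := `[< exists v : 'I_m -> M, isometries p v >].
have Q0 : exists m, Q m.
  by exists 0%N; apply/asboolP; exists (fun _ => 0) => -[].
have Qb m : Q m -> (m <= Num.bound (rtau p)^-1)%N.
  move=> /asboolP[v vp]; have uE := isometries_mxunits pp' vp.
  have := rtau_proj_le1 (supp_proj uE).
  have -> : rtau (supp (fun i j => v i * star (v j))) = rtau p *+ m.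
    rewrite /supp (big_morph (@rtau _ _ R) (@rtauD _ _ R) (id1 := 0)); last first.
      by rewrite /rtau (tau0 R : tau 0 = 0).
    under eq_bigr => i _ do rewrite /rtau tauC vp eqxx -/(rtau p).
    by rewrite sumr_const card_ord.
  rewrite -[leLHS]mulr_natl -ler_pdivlMr // mul1r => mle; apply/ltnW.
  rewrite -(ltr_nat K); apply: le_lt_trans mle _.
  by apply: archi_boundP; rewrite invr_ge0 ltW.
have [m /asboolP[v vp] mmax] := ex_maxnP Q0 Qb.
have uE := isometries_mxunits pp' vp; set E := fun i j => _ in uE.
have s1 : supp E = 1.
  apply/eqP; rewrite eq_sym -subr_eq0; apply/negPn/negP => q0.
  have [x y0] := factor_link p0 q0.
  have [w [w0 [sw ww] wi wP]] := polar_nz y0.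
  have qw : (1 - supp E) * w = w.
    apply: (wP (fun z => _ * z = z)); first exact: polar_stable_fixl.
    by rewrite !mulrA (projC (supp_proj uE)).2.
  have wp : w * p = w.
    by apply: (wP (fun z => z * p = z)); [exact: polar_stable_fixr|rewrite -mulrA pp].
  have wwp : star w * w = p.
    have h : p * (star w * w) = star w * w by rewrite mulrA -sp -starM wp.
    have [e0|//] := pm _ (conj sw ww) h.
    by move: w0; rewrite (star_mul_eq0 e0) eqxx.
  have vw i : star (v i) * w = 0.
    have vi : star (v i) * (1 - supp E) = 0.
      have [sE _] := supp_proj uE.
      rewrite mulrBr mulr1 -sE -starM (isometries_supp pp' vp).
      by rewrite subrr.
    by rewrite -qw mulrA vi mul0r.
  suff : Q m.+1 by move/mmax; rewrite ltnn.
  apply/asboolP; exists (fun i => if unlift ord0 i is Some j then v j else w) => i j.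
  case: (unliftP ord0 i) => [i' ->|->]; case: (unliftP ord0 j) => [j' ->|->].
  - by rewrite (inj_eq lift_inj) vp.
  - by rewrite vw eq_sym (negPf (neq_lift _ _)).
  - by rewrite (negPf (neq_lift _ _)) -[LHS]starK starM starK vw star0.
  - by rewrite eqxx.
have cP (x : M) ij : exists c, star (v ij.1) * x * v ij.2 = c *: p.
  apply: minimal_scalar => //.
  have vi := isometries_fixr pp' vp.
  by rewrite -[in RHS](vi ij.1) -[in RHS](vi ij.2) starM sp !mulrA.
exists #|{: 'I_m * 'I_m}|, (fun k => op_fun (E (enum_val k).1 (enum_val k).2)).
move=> T AT; have [c cE] := boolp.choice (cP (VnOp AT)).
exists (fun k => c (enum_val k)).
rewrite -(big_enum_val (A := {: 'I_m * 'I_m})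
  (fun ij => c ij *: op_fun (E ij.1 ij.2))) /=.
suff e : VnOp AT = \sum_(ij in {: 'I_m * 'I_m}) c ij *: E ij.1 ij.2.
  by rewrite -[LHS]/(op_fun (VnOp AT)) e op_fun_sum.
rewrite -[LHS]mulr1 -[LHS]mul1r -s1.
rewrite /supp mulr_suml; under eq_bigr => i _ do rewrite !mulr_sumr.
rewrite pair_bigA /=; apply: eq_big => [//|[i j] _ /=].
have -> : E i i * (VnOp AT * E j j) = v i * (star (v i) * VnOp AT * v j) * star (v j).
  by rewrite /E !mulrA.
by rewrite (cE (i, j)) -scalerAr -scalerAl (isometries_fixr pp' vp).
Qed.

End TypeII.

(** * Matrix units of every size *)

Section FullUnits.
Variables (K : realType) (H : hilbert K) (R : II1_factor H).
Local Notation M := (vnop R).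
Local Notation C := K[i].
Implicit Types (x y z b e f p q : M) (c : C).

Lemma proper_subproj p : is_proj p -> p != 0 ->
  exists f, [/\ is_proj f, p * f = f, f != 0 & f != p].
Proof.
move=> pp p0; apply: contrapT => nf.
apply: (II1_infinite (i := R)); apply: (@minimal_finite_dim _ _ R p).
split=> // f pf ff; have [->|f0] := eqVneq f 0; first by left.
have [->|fp] := eqVneq f p; first by right.
by case: nf; exists f.
Qed.

(** Below p there is a family, indexed by I, of orthogonal equivalent nonzero
    projections. *)
Definition divisible (I : finType) p := exists e (v : I -> M),
  [/\ is_proj e, e != 0, isometries e v & forall i, p * v i = v i].

(** Split p into f and p - f and take the polar part w of an element linking them:
    its final projection is below f and its initial projection w^* w is below
    p - f. *)
Lemma divisible_bool p : is_proj p -> p != 0 -> divisible bool p.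
Proof.
move=> pp p0; have [sp ppe] := pp.
have [f [pf ff f0 fp]] := proper_subproj pp p0; have [sf ffe] := pf.
have pg := projB pp pf ff; set g := p - f in pg; have [sg gg] := pg.
have g0 : g != 0 by rewrite subr_eq0 eq_sym.
have fg : f * g = 0.
  have fpf : f * p = f by rewrite -sp -sf -starM ff.
  by rewrite mulrBr fpf ffe subrr.
have [x y0] := factor_link g0 f0.
have [w [w0 [se ee] we wP]] := polar_nz y0.
have fw : f * w = w.
  by apply: (wP (fun z => f * z = z)); [exact: polar_stable_fixl|rewrite !mulrA ffe].
have wg : w * g = w.
  by apply: (wP (fun z => z * g = z)); [exact: polar_stable_fixr|rewrite -mulrA gg].
have ge : g * (star w * w) = star w * w by rewrite mulrA -{1}sg -starM wg.
have wsw : star w * (star w * w) = 0.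
  by rewrite -{1}fw starM sf -ge -mulrA (mulrA f) fg mul0r mulr0.
exists (star w * w), (fun i : bool => if i then w else star w * w); split.
- by split.
- by apply: contra w0 => /eqP/star_mul_eq0->.
- case=> [] [] //=; rewrite ?se ?ee //.
  by have := congr1 (@star _ _ R) wsw; rewrite star0 starM starK se.
- case; first by rewrite -fw mulrA ff.
  by rewrite -ge mulrA mulrBr ppe ff.
Qed.

Lemma divisible_prod (I J : finType) p :
  divisible I p -> (forall q, is_proj q -> q != 0 -> divisible J q) ->
  divisible (I * J)%type p.
Proof.
move=> [e [v [pe e0 ve pv]]] dJ; have [f [w [pf f0 wf ew]]] := dJ e pe e0.
exists f, (fun ij => v ij.1 * w ij.2); split => //.
- move=> [i j] [k l] /=; rewrite starM -mulrA (mulrA (star (v i))) ve xpair_eqE.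
  case: eqP => _ /=; last by rewrite mul0r mulr0.
  by rewrite ew wf.
- by move=> [i j] /=; rewrite mulrA pv.
Qed.

Lemma divisible_inj (I J : finType) p (h : I -> J) : injective h ->
  divisible J p -> divisible I p.
Proof.
move=> hi [e [v [pe e0 ve pv]]]; exists e, (v \o h); split=> //= i j.
by rewrite ve (inj_eq hi).
Qed.

Lemma divisible_all (I : finType) p : is_proj p -> p != 0 -> divisible I p.
Proof.
have pow k : exists J : finType, #|J| = (2 ^ k)%N /\
    forall q, is_proj q -> q != 0 -> divisible J q.
  elim: k => [|k [J [cJ dJ]]].
    exists unit; split; first exact: card_unit.
    move=> q pq q0; apply: (@divisible_inj _ _ _ (fun=> true)) (divisible_bool pq q0).
    by move=> [] [].
  exists (bool * J)%type; split; first by rewrite card_prod card_bool cJ expnS.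
  by move=> q pq q0; apply: divisible_prod => //; exact: divisible_bool.
move=> pp p0; have [J [cJ dJ]] := pow #|I|.
have cIJ : (#|I| <= #|J|)%N by rewrite cJ ltnW // ltn_expl.
pose h (i : I) : J := enum_val (widen_ord cIJ (enum_rank i)).
apply: (@divisible_inj _ _ _ h) (dJ _ pp p0).
by move=> i j /enum_val_inj /(congr1 val) /= /val_inj /enum_rank_inj.
Qed.

(** After exhaustion, a nonzero remainder 1 - supp E would be divisible and contain
    another system. *)
Lemma full_mxunits (I : finType) (i0 : I) :
  exists2 E : I -> I -> M, mxunits E & supp E = 1.
Proof.
have [E [[uE _] Emax]] := @exhaustion _ _ R I (fun=> True) Logic.I
  (fun _ _ _ _ => Logic.I) (fun _ _ _ _ => Logic.I).
exists E => //; apply/eqP; rewrite eq_sym -subr_eq0; apply/negPn/negP => q0.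
have [e [v [pe e0 ve qv]]] := divisible_all I (projC (supp_proj uE)) q0.
have uF := isometries_mxunits pe ve.
have Ev i : supp E * v i = 0.
  by rewrite -qv mulrA mulrBr mulr1 (supp_proj uE).2 subrr mul0r.
have F0 : supp (fun i j => v i * star (v j)) = 0.
  apply: Emax => //; rewrite [X in _ * X]/supp mulr_sumr big1 // => i _.
  by rewrite mulrA Ev mul0r.
have vi0 : v i0 = 0 by rewrite -(isometries_supp pe ve) F0 mul0r.
by have := ve i0 i0; rewrite eqxx vi0 mulr0 => e1; rewrite -e1 eqxx in e0.
Qed.

(** * Finite groups in the unitary group *)

(** The permutation matrices of left translations.  An off-diagonal matrix unit
    has trace 0 as E i j = E i j E j j while E j j E i j = 0, and left translation
    by g <> 1 has no fixed point. *)
Lemma regular_representation (gT : finGroupType) : exists U : gT -> M,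
  [/\ forall g h, U (g * h)%g = U g * U h, U 1%g = 1,
      forall g, star (U g) = U g^-1%g
    & forall g, tau (U g) = (g == 1%g)%:R].
Proof.
have [E uE sE] := full_mxunits (1%g : gT).
exists (fun g => \sum_h E (g * h)%g h); split.
- move=> g h; rewrite mulr_suml.
  under [RHS]eq_bigr => i _ do rewrite mulr_sumr.
  rewrite exchange_big /=; apply: eq_bigr => k _.
  rewrite (bigD1 (h * k)%g) //= uE.2 eqxx mulgA big1 ?addr0 // => i ik.
  by rewrite uE.2 (negPf ik).
- by under eq_bigr => i _ do rewrite mul1g.
- move=> g; rewrite star_sum (reindex_inj (mulgI g^-1)%g) /=.
  by apply: eq_bigr => i _; rewrite uE.1 mulKVg.
- move=> g; rewrite tau_sum; have [->|g1] := eqVneq g 1%g.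
    under eq_bigr => i _ do rewrite mul1g.
    by rewrite -tau_sum -/(supp E) sE tau1.
  rewrite big1 // => i _.
  have gi : i == (g * i)%g = false.
    by apply: contraNF g1 => /eqP h; rewrite -(mulgK i g) -h mulgV.
  have -> : E (g * i)%g i = E (g * i)%g i * E i i by rewrite uE.2 eqxx.
  by rewrite tauC uE.2 gi (tau0 R : tau 0 = 0).
Qed.

End FullUnits.

Local Open Scope quotient_scope.

(** * Calculus in the tracial ultrapower *)

Section SquareNorm.
Variables (K : realType) (H : hilbert K) (R : II1_factor H).
Local Notation M := (vnop R).
Local Notation C := K[i].
Implicit Types (x y z : M) (c : C).

Definition sqn x : C := tau (star x * x).

Lemma sqn_ge0 x : 0 <= sqn x. Proof. exact: tau_ge0. Qed.

Lemma sqnE x : sqnorm2 R x = sqn x. Proof. by []. Qed.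

Lemma sqn_star x : sqn (star x) = sqn x.
Proof. by rewrite /sqn starK tauC. Qed.

Lemma sqnZ c x : sqn (c *: x) = `|c| ^+ 2 * sqn x.
Proof.
by rewrite /sqn starZ -scalerAl -scalerAr scalerA tauZ [_ * c]mulrC -normCK.
Qed.

Lemma sqnD_le x y : sqn (x + y) <= (sqn x + sqn y) *+ 2.
Proof.
have := sqnorm2_parallelogram (op_mem x) (op_mem y).
rewrite -(sqnE x) -(sqnE y) => <-; rewrite lerDl.
exact: (sqn_ge0 (x - y)).
Qed.

(** The two multiplicative bounds for the 2-norm both come from this one, the
    right-hand one by taking adjoints. *)
Lemma sqnM_le c x y : 0 < c -> (forall v, `|x v| <= c * `|v|) ->
  sqn (x * y) <= c ^+ 2 * sqn y.
Proof.
move=> c0 xc; have cc : contractive (c^-1 *: x).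
  by move=> v; rewrite opZ normrZ gtr0_norm ?invr_gt0 // ler_pdivrMl.
have := tau_contractive y cc; rewrite -/(sqn _) -/(sqn y) -scalerAl sqnZ.
rewrite gtr0_norm ?invr_gt0 // exprVn ler_pdivrMl ?exprn_gt0 //.
Qed.

(** A positive functional is hermitian: tau y + tau y^* is real for every y, here
    taken to be x and i x. *)
Lemma tau_star x : tau (star x) = conjC (tau x).
Proof.
have realsum y : conjC (tau y + tau (star y)) = tau y + tau (star y).
  have r u : conjC (sqn u) = sqn u by rewrite geC0_conj // sqn_ge0.
  have e : tau y + tau (star y) = sqn (1 + y) - sqn y - 1.
    rewrite /sqn starD star1 mulrDl !mulrDr !mul1r mulr1 !tauD tau1.
    by ring.
  by rewrite e !rmorphB rmorph1 /= !r.
have h1 := realsum x; have h2 := realsum ('i *: x).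
have i0 : ('i : C) != 0 by exact: neq0Ci.
rewrite starZ conjCi !tauZ mulNr -mulrBr rmorphM /= conjCi mulNr -mulrN in h2.
move/(mulfI i0): h2; rewrite rmorphB opprB /= => h2.
rewrite rmorphD /= in h1.
have h3 : conjC (tau (star x)) + conjC (tau (star x)) = tau x + tau x.
  transitivity ((conjC (tau x) + conjC (tau (star x)))
     + (conjC (tau (star x)) - conjC (tau x))); first by ring.
  by rewrite h1 h2; ring.
apply/esym; rewrite -[RHS]conjCK; congr conjC.
apply: (mulfI (x := 2)); first by rewrite pnatr_eq0.
by rewrite !mulr_natl !mulr2n -h3.
Qed.

(** Expand the square of the 2-norm of x - tau x. *)
Lemma tau_cauchy_schwarz x : `|tau x| ^+ 2 <= sqn x.
Proof.
have := sqn_ge0 (x - tau x *: 1).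
rewrite /sqn starB starZ star1 mulrBl !mulrBr -!scalerAr -!scalerAl !mulr1 !mul1r.
rewrite !tauB !tauZ tau1 tau_star !mulr1 normCK.
by rewrite [conjC _ * _]mulrC subrr subr0 subr_ge0.
Qed.

End SquareNorm.

(** A free ultrafilter contains the complement of each point. *)
Lemma ultrafilter_cofinite (omega : free_ultrafilter) N :
  ufilter omega [set n | (N <= n)%N].
Proof.
elim: N => [|N IHN]; first by apply: filterS filterT => n _.
have := in_ultra_setVsetC [set N] (ufilter_ultra omega).
case=> [/ufilter_free//|h]; apply: filterS (filterI IHN h) => n [/= Nn nN].
by rewrite ltn_neqAle Nn andbT; apply/eqP => e; exact: nN.
Qed.

Lemma free_ultrafilter_exists : exists omega : free_ultrafilter, True.
Proof.
have [G [Gu fG]] := ultraFilterLemma (eventually_filter : ProperFilter \oo).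
unshelve eexists; last by [].
apply: (FreeUltrafilter Gu) => n Gn.
have : G [set m | (n < m)%N] by apply: fG; exists n.+1.
move=> /(filterI Gn) /filter_ex [m [/= -> ]].
by rewrite ltnn.
Qed.

Section Ultrapower.
Variables (K : realType) (H : hilbert K) (R : II1_factor H).
Variable omega : free_ultrafilter.
Local Notation M := (vnop R).
Local Notation C := K[i].
Local Notation U := (ultrapower R omega).
Implicit Types (x y z : linfty R).

Let omega_filter : ProperFilter (ufilter omega).
Proof. exact: _. Qed.

Definition entry x n : M := VnOp (lseq_mem x n).

Lemma leqvE x y : leqv omega x y <->
  ((fun n => sqn (entry x n - entry y n)) @ ufilter omega --> (0 : C^o)).
Proof. by []. Qed.

Lemma up_classP x y : up_class omega x = up_class omega y <-> leqv omega x y.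
Proof.
split=> [/eqquotP|h]; first by move/asboolP.
by apply/eqquotP/asboolP.
Qed.

Lemma up_reprP (a : U) : up_class omega (up_repr a) = a.
Proof. by rewrite /up_class /up_repr reprK. Qed.

Lemma squeeze0 (f g : nat -> C) (c : C) : 0 < c ->
  (forall n, 0 <= f n <= c * g n) -> (g @ ufilter omega --> (0 : C^o)) ->
  f @ ufilter omega --> (0 : C^o).
Proof.
move=> c0 fg g0; have FF : Filter (ufilter omega) by exact: _.
apply/(cvgr0Pnorm_lt (V := C^o)) => e e0.
have h := (cvgr0Pnorm_lt (FF := FF) (V := C^o) _).1 g0 (e / c) (divr_gt0 e0 c0).
apply: filterS h => n; have /andP[f0 fgn] := fg n.
have gn0 : 0 <= g n by rewrite -(pmulr_rge0 _ c0) (le_trans f0).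
by rewrite !ger0_norm // ltr_pdivlMr // mulrC; exact: le_lt_trans.
Qed.

Lemma linfty_bound x : exists2 c : C, 0 < c & forall n v, `|entry x n v| <= c * `|v|.
Proof.
have [c xc] := lseq_bounded x; exists (`|c| + 1); first by rewrite ltr_wpDl.
move=> n v; apply: le_trans (xc n v) _.
have : c * `|v| <= `|c| * `|v|.
  rewrite -[X in _ <= _ * X]normr_id -normrM real_ler_norm //.
  by rewrite realE (le_trans (normr_ge0 _) (xc n v)).
by move=> h; apply: le_trans h _; rewrite ler_wpM2r // lerDl.
Qed.

(** x y - x' y' = x (y - y') + (x - x') y', with bounded factors x and y' *)
Lemma leqv_lmul x x' y y' : leqv omega x x' -> leqv omega y y' ->
  leqv omega (lmul x y) (lmul x' y').
Proof.
rewrite !leqvE => xx yy; have FF : Filter (ufilter omega) by exact: _.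
have [c c0 xc] := linfty_bound x; have [d d0 yd] := linfty_bound (lstar y').
pose g n := sqn (entry x n - entry x' n) + sqn (entry y n - entry y' n).
have g0 : g @ ufilter omega --> (0 : C^o).
  by rewrite -[0](addr0 (0 : C)); apply: (@cvgD _ C^o).
apply: (squeeze0 (g := g) (c := (c ^+ 2 + d ^+ 2) *+ 2)) g0.
  by rewrite pmulrn_lgt0 // addr_gt0 // exprn_gt0.
move=> n; rewrite sqn_ge0 /=.
have -> : entry (lmul x y) n - entry (lmul x' y') n =
    entry x n * (entry y n - entry y' n) + (entry x n - entry x' n) * entry y' n.
  have e (u v : linfty R) : entry (lmul u v) n = entry u n * entry v n by exact: op_eq.
  by rewrite !e mulrBr mulrBl addrA subrK.
apply: le_trans (sqnD_le _ _) _; rewrite mulrnAl; apply: (ler_wMn2r 2).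
rewrite [leRHS]mulrDl.
apply: lerD.
  apply: le_trans (sqnM_le _ c0 (xc n)) _.
  by rewrite ler_pM2l ?exprn_gt0 // /g lerDr sqn_ge0.
rewrite -sqn_star starM.
have yE : star (entry y' n) = entry (lstar y') n by exact: op_eq.
rewrite yE; apply: le_trans (sqnM_le _ d0 (yd n)) _.
by rewrite sqn_star ler_pM2l ?exprn_gt0 // /g lerDl sqn_ge0.
Qed.

Lemma leqv_lstar x y : leqv omega x y -> leqv omega (lstar x) (lstar y).
Proof.
rewrite !leqvE.
have -> // : (fun n => sqn (entry (lstar x) n - entry (lstar y) n)) =
  (fun n => sqn (entry x n - entry y n)).
apply/funext => n; rewrite -[RHS]sqn_star starB.
by congr (sqn (_ - _)); exact: op_eq.
Qed.

Lemma leqv_repr x : leqv omega (up_repr (up_class omega x)) x.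
Proof. by apply/up_classP; rewrite up_reprP. Qed.

Lemma up_mulE x y :
  up_mul (up_class omega x) (up_class omega y) = up_class omega (lmul x y).
Proof. by apply/up_classP/leqv_lmul; exact: leqv_repr. Qed.

Lemma up_starE x : up_star (up_class omega x) = up_class omega (lstar x).
Proof. by apply/up_classP/leqv_lstar/leqv_repr. Qed.

(** The trace is continuous for the 2-norm, so the limit may be computed on any
    representative. *)
Lemma up_traceE x (l : C) :
  (fun n => tau (entry x n)) @ ufilter omega --> (l : C^o) ->
  up_trace (up_class omega x) = l.
Proof.
move=> xl; have FF : Filter (ufilter omega) by exact: _.
set r := up_repr (up_class omega x).
have /leqvE rx : leqv omega r x by exact: leqv_repr.
have d0 : (fun n => tau (entry r n - entry x n)) @ ufilter omega --> (0 : C^o).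
  apply/(cvgr0Pnorm_lt (V := C^o)) => e e0.
  have h := (cvgr0Pnorm_lt (FF := FF) (V := C^o) _).1 rx (e ^+ 2) (exprn_gt0 2 e0).
  apply: filterS h => n; rewrite ger0_norm ?sqn_ge0 // => h.
  rewrite -(@ltr_pXn2r _ 2) ?nnegrE ?(ltW e0) //.
  exact: le_lt_trans (tau_cauchy_schwarz _) h.
have rl : (fun n => tau (entry r n)) @ ufilter omega --> (l : C^o).
  have -> : (fun n => tau (entry r n)) =
      (fun n => tau (entry r n - entry x n) + tau (entry x n)).
    by apply/funext => n; rewrite -tauD subrK.
  have h := @cvgD _ C^o _ _ FF _ _ _ _ d0 xl.
  by rewrite add0r in h; exact: h.
exact: (cvg_lim (@norm_hausdorff _ C^o) rl).
Qed.

Fact mkup_bounded (u : nat -> M) : (forall n, contractive (u n)) ->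
  bounded_seq (fun n => op_fun (u n)).
Proof. by move=> uc; exists 1 => n v; rewrite mul1r; exact: uc. Qed.

Definition mklinfty (u : nat -> M) (uc : forall n, contractive (u n)) :=
  LInfty (fun n => op_mem (u n)) (mkup_bounded uc).

Lemma linfty_class_eq x y : (forall n, entry x n = entry y n) ->
  up_class omega x = up_class omega y.
Proof.
move=> xy; apply/up_classP/leqvE.
have -> : (fun n => sqn (entry x n - entry y n)) = (fun=> 0).
  by apply/funext => n; rewrite xy subrr /sqn mulr0 (tau0 R : tau 0 = 0).
exact: (@cvg_cst C^o).
Qed.

Lemma up_mul1 (a : U) : up_mul a (up_one R omega) = a.
Proof.
rewrite -[a]up_reprP up_mulE; apply: linfty_class_eq => n.
exact: op_eq.
Qed.

End Ultrapower.

(** * The free group on a continuum of generators *)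

Section Embedding.
Variables (K : realType) (H : hilbert K) (R : II1_factor H).
Local Notation M := (vnop R).
Local Notation C := K[i].

(** A quotient of the free group on the 0-1 words of length n that is faithful on
    the ball of radius n, with a unitary representation whose trace is that of the
    regular representation *)
Record ball_rep n := BallRep {
  br_group : finGroupType;
  br_gen : {ffun 'I_n -> bool} -> br_group;
  br_free : forall w, reduced w -> (size w <= n)%N ->
    weval br_gen w = 1%g -> w = [::];
  br_op : br_group -> M;
  br_opM : forall g h, br_op (g * h)%g = br_op g * br_op h;
  br_op1 : br_op 1%g = 1;
  br_opV : forall g, star (br_op g) = br_op g^-1%g;
  br_tau : forall g, tau (br_op g) = (g == 1%g)%:R }.

Lemma ball_rep_exists : exists _ : forall n, ball_rep n, True.
Proof.
suff h n : exists _ : ball_rep n, True by exists (fun n => projT1 (cid (h n))).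
have [gT [s sP]] := finite_quotient {ffun 'I_n -> bool} n.
have [U [UM U1 UV Ut]] := regular_representation R gT.
by exists (BallRep sP UM U1 UV Ut).
Qed.

(** The n-th coordinate of the embedding sees a generator through its first n
    bits. *)
Definition code (X : Type) (k : X -> nat -> bool) n (x : X) :
  {ffun 'I_n -> bool} := [ffun i : 'I_n => k x i].

(** Only the finitely many pairs of adjacent letters matter, and two distinct
    generators differ in one bit. *)
Lemma code_reduced (X : eqType) (k : X -> nat -> bool) (w : seq (X * bool)) :
  injective k -> reduced w ->
  exists N, forall n, (N <= n)%N -> reduced [seq (code k n l.1, l.2) | l <- w].
Proof.
move=> ki; case: w => [|l w]; first by exists 0%N.
rewrite /reduced /=; elim: w l => [|l' w IHw] l; first by exists 0%N.
move=> /= /andP[ll' /IHw [N hN]].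
have [N' hN'] : exists N', forall n, (N' <= n)%N ->
    (code k n l'.1, l'.2) != linv (code k n l.1, l.2).
  case: l l' ll' {hN IHw} => x b [x' b'] /=; rewrite /linv !xpair_eqE /=.
  have [->|bb] := eqVneq b' (~~ b); last first.
    by exists 0%N => n _; rewrite xpair_eqE /= (negPf bb) andbF.
  rewrite andbT => xx.
  have [i ki'] : exists i, k x' i != k x i.
    apply: contrapT => /forallNP h; move/eqP: xx; apply; apply: ki.
    by apply/funext => i; apply/eqP/negPn/negP; exact: h.
  exists i.+1 => n ni; rewrite xpair_eqE /= eqxx andbT.
  apply: contra ki' => /eqP/ffunP/(_ (Ordinal ni)).
  by rewrite !ffunE => ->.
exists (maxn N N') => n; rewrite geq_max => /andP[nN nN'].
by rewrite hN' //= hN.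
Qed.

Section UnitarySequence.
Variables (B : forall n, ball_rep n) (omega : free_ultrafilter).

Lemma br_contractive n g : contractive (br_op (b := B n) g).
Proof.
apply: psd_contractive; rewrite br_opV -br_opM mulVg br_op1 subrr => v.
by rewrite op0 dotp0l.
Qed.

Definition br_class (g : forall n, br_group (B n)) : ultrapower R omega :=
  up_class omega (mklinfty (fun n => @br_contractive n (g n))).

Lemma br_class_eq g h : (forall n, g n = h n) -> br_class g = br_class h.
Proof.
by move=> gh; apply: linfty_class_eq => n; apply: op_eq => v /=; rewrite gh.
Qed.

Lemma br_classM g h :
  up_mul (br_class g) (br_class h) = br_class (fun n => (g n * h n)%g).
Proof.
rewrite /br_class up_mulE; apply: linfty_class_eq => n; apply: op_eq => v /=.
by rewrite br_opM.
Qed.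

Lemma br_classV g : up_star (br_class g) = br_class (fun n => (g n)^-1%g).
Proof.
rewrite /br_class up_starE; apply: linfty_class_eq => n.
rewrite -[RHS]/(entry _ n); apply: op_eq => v /=.
by rewrite -[RHS]/(br_op (g n)^-1%g v) -br_opV.
Qed.

Lemma br_class1 : br_class (fun n => 1%g) = up_one R omega.
Proof.
by apply: linfty_class_eq => n; apply: op_eq => v /=; rewrite br_op1.
Qed.

Lemma br_class_unitary g : up_unitary (br_class g).
Proof.
split; rewrite br_classV br_classM -br_class1; apply: br_class_eq => n.
  exact: mulVg.
exact: mulgV.
Qed.

Lemma br_class_trace g (b : bool) N :
  (forall n, (N <= n)%N -> (g n == 1%g) = b) -> up_trace (br_class g) = b%:R.
Proof.
move=> gb; apply: up_traceE; have FF : Filter (ufilter omega) by exact: _.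
apply/(cvgrPdist_lt (V := C^o)) => e e0.
apply: filterS (ultrafilter_cofinite omega N) => n /= Nn.
have -> : entry (mklinfty (fun n => @br_contractive n (g n))) n = br_op (g n).
  exact: op_eq.
by rewrite br_tau gb // subrr normr0.
Qed.

(** A reduced word of length l on generators separated by their first N bits has
    trace 0 in all coordinates from max (N, l) on. *)
Lemma free_embedding (X : Type) (G : groupType) (gen : X -> G)
    (k : X -> nat -> bool) : injective k -> free_group_on gen ->
  exists theta : G -> ultrapower R omega,
    [/\ forall g, up_unitary (theta g),
        forall g h, theta (g * h)%g = up_mul (theta g) (theta h)
      & forall g, g != 1%g -> up_trace (theta g) = 0].
Proof.
move=> ki fr.
have phiE n : exists phi : G -> br_group (B n),
    (forall g h, phi (g * h)%g = (phi g * phi h)%g) /\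
    (forall x, phi (gen x) = br_gen (B n) (code k n x)).
  have [phi [h _]] := fr (br_group (B n)) (fun x => br_gen (B n) (code k n x)).
  by exists phi.
pose phi n := projT1 (cid (phiE n)).
have phiM n g h : phi n (g * h)%g = (phi n g * phi n h)%g.
  by rewrite /phi; case: cid => f [].
have phig n x : phi n (gen x) = br_gen (B n) (code k n x).
  by rewrite /phi; case: cid => f [].
exists (fun g => br_class (fun n => phi n g)); split.
- by move=> g; exact: br_class_unitary.
- by move=> g h; rewrite br_classM; apply: br_class_eq => n; exact: phiM.
move=> g g1; have [w0 w0E] := free_generated fr g.
(* comparing letters requires a decidable equality on X *)
have [w rw wE] := @weval_reduced {classic X} G gen w0.
rewrite w0E in wE; have w1 : w != [::].
  by apply: contra g1 => /eqP w0'; rewrite -wE w0'.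
have [N hN] := @code_reduced {classic X} k w ki rw.
apply: (@br_class_trace _ false (maxn N (size w))) => n.
rewrite geq_max => /andP[nN nw]; apply/negP => /eqP phi1.
have phiw : weval (br_gen (B n)) [seq (code k n l.1, l.2) | l <- w] = 1%g.
  rewrite weval_map -phi1 -wE (weval_morph _ _ (phiM n)).
  by congr weval; apply/funext => x /=; rewrite phig.
have := br_free (hN n nN) _ phiw; rewrite size_map => /(_ nw).
by case: (w) w1.
Qed.

(** The trace of u_y^* u_x is that of the reduced word y^-1 x. *)
Lemma continuum_orthonormal : exists u : (nat -> bool) -> ultrapower R omega,
  forall x y, up_trace (up_mul (up_star (u y)) (u x)) = `[< x = y >]%:R.
Proof.
exists (fun x => br_class (fun n => br_gen (B n) (code id n x))) => x y.
rewrite br_classV br_classM.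
case: (asboolP (x = y)) => [->|xy].
  apply: (@br_class_trace _ true 0) => n _; by rewrite mulVg eqxx.
pose w : seq ({classic (nat -> bool)} * bool) := [:: (x, true); (y, false)].
have rw : reduced w by rewrite /= andbT xpair_eqE /= andbT eq_sym; apply/eqP.
have [N hN] := @code_reduced {classic (nat -> bool)} id w (fun _ _ => id) rw.
apply: (@br_class_trace _ false (maxn N 2)) => n.
rewrite geq_max => /andP[nN n2]; apply/negP => /eqP e.
have h : weval (br_gen (B n)) [seq (code id n l.1, l.2) | l <- w] = 1%g.
  by rewrite /w /= /leval /= mul1g.
by have := br_free (hN n nN) n2 h.
Qed.

End UnitarySequence.
End Embedding.

(** A real is determined by the rationals above it. *)
Lemma real_code (K : realType) : exists k : K -> nat -> bool, injective k.
Proof.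
pose cut (x : K) n := if @choice.unpickle rat n is Some q then x < ratr q else false.
exists cut => x y xy.
have aux (a b : K) : a < b -> cut a <> cut b.
  move=> /rat_in_itvoo [q]; rewrite in_itv /= => /andP[aq qb].
  move=> /(congr1 (fun f => f (choice.pickle q))).
  rewrite /cut choice.pickleK aq.
  by move=> /esym; rewrite ltNge ltW.
by case: (ltgtP x y) => // h; have := aux _ _ h; rewrite xy => /(_ erefl).
Qed.

(** Cantor's diagonal argument for an injection f into nat: the sequence g lies in
    its own diagonal if and only if it does not. *)
Lemma uncountable_cantor : ~ countable [set: nat -> bool].
Proof.
move=> /countable_injP [f fi].
pose g n := `[< exists2 x : nat -> bool, f x = n & ~~ x n >].
have fg x : f x = f g -> x = g by apply: fi; rewrite in_setT.
have [gt|gf] := boolP (g (f g)).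
  move: (gt) => /asboolP [x /fg -> ]; by rewrite gt.
by move: (gf) => /asboolP; apply; exists g.
Qed.

(** * Nonseparability *)

Section Bessel.
Variables (K : realType) (L : hilbert K).
Local Notation C := K[i].
Local Notation "''<' x , y >" := (dotp L x y).

Lemma dotp_suml (I : Type) (s : seq I) (F : I -> L) y :
  '<\sum_(i <- s) F i, y> = \sum_(i <- s) '<F i, y>.
Proof.
apply: (big_morph (fun x => '<x, y>)) => [a b|]; first exact: dotpDl.
by rewrite -(scale0r (0 : L)) dotpZl mul0r.
Qed.

Lemma dotp_sumr (I : Type) (s : seq I) (F : I -> L) y :
  '<y, \sum_(i <- s) F i> = \sum_(i <- s) '<y, F i>.
Proof.
apply: (big_morph (fun x => '<y, x>)) => [a b|]; first exact: dotpDr.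
by rewrite -(scale0r (0 : L)) dotpZr conjC0 mul0r.
Qed.

Lemma bessel (I : eqType) (e : I -> L) (s : seq I) d :
  (forall i j, '<e i, e j> = (i == j)%:R) -> uniq s ->
  \sum_(i <- s) `|'<d, e i>| ^+ 2 <= `|d| ^+ 2.
Proof.
move=> eo us; set S := \sum_(i <- s) _.
pose p := \sum_(i <- s) '<d, e i> *: e i.
have pd : '<p, d> = S.
  rewrite /p dotp_suml; apply: eq_bigr => i _.
  by rewrite dotpZl (dotpC (e i)) normCK.
have pe j : j \in s -> '<p, e j> = '<d, e j>.
  move=> js; rewrite /p dotp_suml (bigD1_seq j) //= dotpZl eo eqxx mulr1.
  by rewrite big1 ?addr0 // => i ij; rewrite dotpZl eo (negPf ij) mulr0.
have pp : '<p, p> = S.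
  rewrite {2}/p dotp_sumr /S; apply: eq_big_seq => i si.
  by rewrite dotpZr pe // normCK mulrC.
have dp : '<d, p> = S by rewrite dotpC pd -pp -dotpC.
have := exprn_ge0 2 (normr_ge0 (d - p)).
rewrite (dotpE (d - p)) dotpDl !dotpDr !dotpNl !dotpNr pd pp dp opprK -dotpE addNr addr0.
by rewrite subr_ge0.
Qed.

Lemma complex_archi (x : C) : 0 <= x -> exists n, x < n%:R.
Proof.
case: x => a b; rewrite lecE /= => /andP[/eqP-> a0].
exists (Num.bound a); have -> : (Num.bound a)%:R = ((Num.bound a)%:R : K)%:C%C.
  by rewrite rmorph_nat.
by rewrite ltcR; exact: archi_boundP.
Qed.

(** By Bessel's inequality only finitely many coefficients have square modulus at
    least 1 / m. *)
Lemma bessel_countable (I : choiceType) (e : I -> L) d :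
  (forall i j, '<e i, e j> = (i == j)%:R) ->
  countable [set i | '<d, e i> != 0].
Proof.
move=> eo; pose F m := [set i | 1 <= `|'<d, e i>| ^+ 2 *+ m].
have Fc m : countable (F m).
  apply: finite_set_countable; apply: contrapT => Finf.
  have [n dn] : exists n, `|d| ^+ 2 *+ m < n%:R.
    by apply: complex_archi; rewrite mulrn_wge0 // exprn_ge0.
  have [B BF Bn] := infinite_set_fset n Finf.
  have := bessel d eo (fset_uniq B) => /(ler_wMn2r m) /le_lt_trans /(_ dn).
  rewrite -sumrMnl => lt_n.
  suff : n%:R < n%:R :> C by rewrite ltxx.
  apply: le_lt_trans lt_n; apply: (@le_trans _ _ (\sum_(i <- B) 1)).
    by rewrite big_const_seq count_predT iter_addr_0 ler_nat.
  rewrite big_seq [leRHS]big_seq; apply: ler_sum => i iB.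
  exact: BF.
have -> : [set i | '<d, e i> != 0] = \bigcup_m F m.
  apply/seteqP; split=> i /=.
    move=> di; have a0 : 0 < `|'<d, e i>| ^+ 2 by rewrite exprn_gt0 // normr_gt0.
    have [|n an] := @complex_archi (`|'<d, e i>| ^+ 2)^-1; first by rewrite invr_ge0 ltW.
    exists n => //; rewrite /F /= -[leRHS]mulr_natl -ler_pdivrMr // mul1r.
    exact: ltW.
  move=> [m _]; rewrite /F /=; apply: contraTneq => ->.
  by rewrite normr0 expr0n mul0rn lt_geF.
exact: bigcup_countable.
Qed.
End Bessel.

Local Open Scope card_scope.

Section Nonseparable.
Variables (K : realType) (H : hilbert K) (R : II1_factor H).
Variables (omega : free_ultrafilter) (L : hilbert K).
Variables (Lambda : ultrapower R omega -> L)
  (pi : ultrapower R omega -> L -> L).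
Hypothesis std : standard_representation Lambda pi.
Local Notation C := K[i].
Local Notation "''<' x , y >" := (dotp L x y).
Local Notation xi := (Lambda (up_one R omega)).

(** The vectors T xi with T in D have, by Bessel's inequality, countably many
    nonzero coefficients on the uncountable orthonormal family, so that one of its
    vectors is orthogonal to all of them. *)
Lemma missed_operator (D : set (L -> L)) : countable D ->
  exists2 a : ultrapower R omega, '<pi a xi, Lambda a> = 1 &
    `|Lambda a| = 1 /\ forall T, D T -> '<T xi, Lambda a> = 0.
Proof.
move=> Dc; have [B _] := ball_rep_exists R.
have [u uo] := continuum_orthonormal B omega.
have eo (x y : {classic (nat -> bool)}) :
    '<Lambda (u x), Lambda (u y)> = (x == y)%:R.
  have e : (x == y) = `[< x = y >].
    by apply/idP/idP => [/eqP/asboolP|/asboolP/eqP].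
  by rewrite (std_dotp std) uo e.
pose S := \bigcup_(T in D) [set x : {classic (nat -> bool)} |
  '<T xi, Lambda (u x)> != 0].
have Sc : countable S.
  by apply: bigcup_countable => // T _; exact: bessel_countable eo.
have [x Sx] : exists x, ~ S x.
  apply: contrapT => /forallNP h; apply: uncountable_cantor.
  by rewrite (_ : setT = S) //; apply/seteqP; split=> // x _; apply: contrapT; exact: h.
exists (u x).
  by rewrite (std_left std) up_mul1 eo eqxx.
split=> [|T DT]; last by apply: contrapT => /eqP Tx; apply: Sx; exists T.
apply/eqP; rewrite -(@eqrXn2 _ 2) // ?ler01 // expr1n dotpE eo eqxx //.
Qed.

Lemma not_sot_separable : ~ sot_separable (range pi).
Proof.
move=> [D [Dc _ Dcl]]; have [a a1 [na aD]] := missed_operator Dc.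
have /Dcl /= : range pi (pi a) by exists a.
pose B := [set T : {ptws L -> L} | `|pi a xi - T xi| < 1].
move=> /(_ B) [|T [DT /=]].
  have h : nbhs (pi a xi) [set y : L | `|pi a xi - y| < 1].
    rewrite -nbhs_ballE; exists 1; first exact: ltr01.
    by move=> y; rewrite -ball_normE.
  exact: (@proj_continuous L (fun=> L) xi (pi a) _ h).
move=> lt1; have : (1 : C) < 1; last by rewrite ltxx.
apply: le_lt_trans lt1; rewrite -[leLHS]normr1 -a1 -[ '<_, _> ]subr0 -(aD _ DT).
rewrite -dotpNl -dotpDl -[leRHS]mulr1 -na; exact: dotp_cauchy_schwarz.
Qed.

Lemma not_wot_separable : ~ wot_separable (range pi).
Proof.
move=> [D [Dc _ Dcl]]; have [a a1 [na aD]] := missed_operator Dc.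
have /Dcl /= : range pi (pi a) by exists a.
pose B := [set f : {ptws (L * L) -> C^o} | `|1 - f (xi, Lambda a)| < 1].
move=> /(_ B) [|_ [[T DT <-] /=]].
  have h : nbhs (1 : C^o) [set y : C^o | `|1 - y| < 1].
    rewrite -nbhs_ballE; exists 1; first exact: ltr01.
    by move=> y; rewrite -ball_normE.
  rewrite -[in X in nbhs X _]a1 in h.
  exact: (@proj_continuous (L * L)%type (fun=> C^o) (xi, Lambda a) (mcoef (pi a)) _ h).
by rewrite /B /mcoef /= aD // subr0 normr1 ltxx.
Qed.

End Nonseparable.

Theorem corollary3p5 (K : realType) (H : hilbert K) (R : II1_factor H)
    (R_hyperfinite : hyperfinite (carrier R)) :
  (forall (X : Type) (G : groupType) (gen : X -> G),
     [set: X] #= [set: K] -> free_group_on gen -> hyperlinear R G) /\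
  (forall (omega : free_ultrafilter) (L : hilbert K)
     (Lambda : ultrapower R omega -> L) (pi : ultrapower R omega -> L -> L),
     standard_representation Lambda pi ->
     ~ wot_separable (range pi) /\ ~ sot_separable (range pi)).
Proof.
split=> [X G gen XK fr|omega L Lambda pi std]; last first.
  by split; [exact: not_wot_separable std|exact: not_sot_separable std].
have [omega _] := free_ultrafilter_exists.
have [B _] := ball_rep_exists R.
have [k ki] := real_code K.
have /card_set_bijP[f [_ fi _]] := XK.
have fi' : injective f by move=> x y; apply: fi; rewrite inE.
by exists omega; apply: (free_embedding B omega (inj_comp ki fi') fr).
Qed.
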